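(* Let $\mathbb{K}$ be a field of characteristic zero and let $\mathcal{A}=\{W_1,\dots,W_t\}$ be an arrangement of $t$ linear subspaces of $\mathbb{K}^n$. Then the intersection ideal $\mathbb{I}'(\mathcal{A})$ in the exterior algebra $E=\bigwedge(x_1,\dots,x_n)$ is $t$-regular. In particular, this ideal is generated in degree at most $t$.
   Context: Here $x_1,\dots,x_n$ are the coordinate functions on $\mathbb{K}^n$, and $E=\bigwedge(x_1,\dots,x_n)$ is the exterior algebra of the dual space $(\mathbb{K}^n)^*$, graded with each $x_i$ in degree $1$. For each $i$ let $S_i$ be the set of linear forms (elements of $(\mathbb{K}^n)^*$) vanishing on $W_i$, and let $J_i$ be the ideal of $E$ generated by $S_i$. The intersection ideal of $\mathcal{A}$ in $E$ is $\mathbb{I}'(\mathcal{A})=\bigcap_{i=1}^t J_i$. (Homogeneous left ideals in $E$ are two-sided.) A finitely generated graded $E$-module $M$ is called $t$-regular (in the sense of Castelnuovo–Mumford) if $\operatorname{Tor}_i^E(M,\mathbb{K})_j=0$ for all $i\ge 0$ and all $j>i+t$; equivalently, the $i$-th free module in the minimal graded free resolution of $M$ over $E$ is generated in degrees at most $i+t$. *)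

(* Defs.v *)
From HB Require Import structures.
From mathcomp Require Import all_boot all_order all_algebra.

Set Implicit Arguments.
Unset Strict Implicit.
Unset Printing Implicit Defensive.

Import GRing.Theory.
Local Open Scope ring_scope.

(* The exterior algebra on n generators in its monomial basis: the value of   *)
(* u at S is the coefficient of x_S = x_{s1} ... x_{sk}, for S = {s1<...<sk}. *)
Definition exterior (K : fieldType) (n : nat) : Type :=
  {ffun {set 'I_n} -> K}.

Section Exterior.
Variables (K : fieldType) (n : nat).
Notation E := (exterior K n).
Implicit Types (u v w : E) (A B C S T U : {set 'I_n}).

HB.instance Definition _ :=
  Vector.copy (exterior K n) {ffun {set 'I_n} -> K^o}.

Lemma ext_addE u v S : (u + v) S = u S + v S. Proof. exact: ffunE. Qed.
Lemma ext_zeroE S : (0 : E) S = 0. Proof. exact: ffunE. Qed.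
Lemma ext_oppE u S : (- u) S = - u S. Proof. exact: ffunE. Qed.
Lemma ext_scaleE (a : K) u S : (a *: u) S = a * u S. Proof. exact: ffunE. Qed.

(* Number of transpositions sorting the concatenation of A and B. *)
Definition ext_inv A B : nat := (\sum_(a in A) \sum_(b in B) (b < a))%N.

(* x_A x_B = ext_sign A B x_(A :|: B) when A and B are disjoint. *)
Definition ext_sign A B : K := (-1) ^+ ext_inv A B.

Definition ext_mul u v : E :=
  [ffun U : {set 'I_n} => \sum_(S : {set 'I_n} | S \subset U)
     ext_sign S (U :\: S) * u S * v (U :\: S)].

Definition ext_mon A : E := [ffun S : {set 'I_n} => (S == A)%:R].

Definition ext_one : E := ext_mon set0.

Lemma ext_sign0l A : ext_sign set0 A = 1.
Proof. by rewrite /ext_sign /ext_inv big_set0. Qed.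

Lemma ext_sign0r A : ext_sign A set0 = 1.
Proof.
by rewrite /ext_sign /ext_inv big1 // => a _; rewrite big_set0.
Qed.

Lemma ext_signUl A B C :
  [disjoint A & B] -> ext_sign (A :|: B) C = ext_sign A C * ext_sign B C.
Proof.
move=> dAB; rewrite /ext_sign /ext_inv -exprD.
by rewrite (big_setID A) /= setUK setDUl setDv set0U (setDidPl _) // disjoint_sym.
Qed.

Lemma ext_signUr A B C :
  [disjoint B & C] -> ext_sign A (B :|: C) = ext_sign A B * ext_sign A C.
Proof.
move=> dBC; rewrite /ext_sign /ext_inv -exprD -big_split /=.
congr (_ ^+ _); apply: eq_bigr => a _.
by rewrite (big_setID B) /= setUK setDUl setDv set0U (setDidPl _) // disjoint_sym.
Qed.

Lemma ext_mulA : associative ext_mul.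
Proof.
move=> u v w; apply/ffunP => U; rewrite !ffunE.
transitivity (\sum_(S : {set 'I_n} | S \subset U)
  \sum_(P : {set 'I_n} | (S \subset P) && (P \subset U))
   ext_sign P (U :\: P) * ext_sign S (P :\: S) *
     u S * v (P :\: S) * w (U :\: P)).
  apply: eq_bigr => S sSU; rewrite ffunE mulr_sumr.
  rewrite (reindex_onto (fun P => P :\: S) (fun T => S :|: T)) /=; last first.
    move=> T; rewrite subsetD => /andP[_ dTS].
    by rewrite setDUl setDv set0U; apply/setDidPl.
  apply: eq_big => [P|P /andP[sPU /eqP eP]].
    apply/andP/andP => [[sPU /eqP <-]|[sSP sPU]].
      rewrite subsetUl subUset sSU; split=> //.
      exact: subset_trans sPU (subsetDl _ _).
    split; first exact: setSD.
    by rewrite setDE setUIr setUCr setIT; apply/eqP/setUidPr.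
  have sSP : S \subset P by rewrite -eP subsetUl.
  have sPU' : P \subset U.
    by rewrite -eP subUset sSU (subset_trans sPU) ?subsetDl.
  have -> : U :\: S :\: (P :\: S) = U :\: P.
    by rewrite setDDl -{2}eP.
  have d1 : [disjoint P :\: S & U :\: P].
    rewrite -setI_eq0; apply/eqP/setP => x; rewrite !inE.
    by case: (x \in P); rewrite ?andbF.
  have d2 : [disjoint S & P :\: S].
    by rewrite -setI_eq0 setIDA setIC -setIDA setDv setI0.
  have -> : U :\: S = (P :\: S) :|: (U :\: P).
    apply/setP => x; rewrite !inE; case: (boolP (x \in P)) => [xP|xNP].
      by rewrite (subsetP sPU') // !andbT orbF.
    by rewrite (contraNN (subsetP sSP x)) // andbF.
  rewrite ext_signUr //.
  have -> : ext_sign P (U :\: P) =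
            ext_sign S (U :\: P) * ext_sign (P :\: S) (U :\: P).
    by rewrite -ext_signUl // eP.
  set a := ext_sign S _; set b := ext_sign S _; set c := ext_sign _ _.
  rewrite -!mulrA [a * (b * _)]mulrCA; congr (_ * _).
  by rewrite [c * (a * _)]mulrCA; congr (_ * _); rewrite mulrCA.
rewrite (exchange_big_dep (fun P : {set 'I_n} => P \subset U)) /=; last first.
  by move=> S P _ /andP[].
apply: eq_bigr => P sPU; rewrite ffunE mulr_sumr mulr_suml.
apply: eq_big => [S|S /andP[_ /andP[sSP _]]].
  rewrite sPU andbT; case: (boolP (S \subset P)) => [sSP|]; rewrite ?andbF //.
  by rewrite (subset_trans sSP sPU).
by rewrite !mulrA.
Qed.

Lemma ext_mul1 : left_id ext_one ext_mul.
Proof.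
move=> u; apply/ffunP => U; rewrite ffunE (bigD1 set0) ?sub0set //=.
rewrite big1 => [|S /andP[_ S0]]; last by rewrite ffunE (negPf S0) mulr0 mul0r.
by rewrite ffunE eqxx setD0 ext_sign0l !mul1r addr0.
Qed.

Lemma ext_mulr1 : right_id ext_one ext_mul.
Proof.
move=> u; apply/ffunP => U; rewrite ffunE (bigD1 U) //=.
rewrite big1 => [|S /andP[sSU SU]]; last first.
  rewrite [X in _ * X]ffunE setD_eq0 (_ : _ \subset _ = false) ?mulr0 //.
  by apply: contraNF SU => sUS; rewrite eqEsubset sSU.
by rewrite setDv [X in _ * X]ffunE eqxx ext_sign0r mul1r mulr1 addr0.
Qed.

Lemma ext_mulDl : left_distributive ext_mul +%R.
Proof.
move=> u v w; apply/ffunP => U; rewrite !ffunE -big_split /=.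
by apply: eq_bigr => S _; rewrite ext_addE mulrDr mulrDl.
Qed.

Lemma ext_mulDr : right_distributive ext_mul +%R.
Proof.
move=> u v w; apply/ffunP => U; rewrite !ffunE -big_split /=.
by apply: eq_bigr => S _; rewrite ext_addE mulrDr.
Qed.

Lemma ext_one_neq0 : ext_one != 0.
Proof.
apply/eqP => /ffunP/(_ set0); rewrite !ffunE eqxx => /eqP.
by rewrite oner_eq0.
Qed.

HB.instance Definition _ := GRing.Zmodule_isNzRing.Build (exterior K n)
  ext_mulA ext_mul1 ext_mulr1 ext_mulDl ext_mulDr ext_one_neq0.

Lemma ext_mulE u v U :
  (u * v) U = \sum_(S : {set 'I_n} | S \subset U)
     ext_sign S (U :\: S) * u S * v (U :\: S).
Proof. exact: ffunE. Qed.

Lemma ext_scaleAl (a : K) u v : a *: (u * v) = a *: u * v.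
Proof.
apply/ffunP => U; rewrite ext_scaleE !ext_mulE mulr_sumr.
by apply: eq_bigr => S _; rewrite ext_scaleE !mulrA [a * _]mulrC.
Qed.

HB.instance Definition _ :=
  GRing.Lmodule_isLalgebra.Build K (exterior K n) ext_scaleAl.

Lemma ext_scaleAr (a : K) u v : a *: (u * v) = u * (a *: v).
Proof.
apply/ffunP => U; rewrite ext_scaleE !ext_mulE mulr_sumr.
by apply: eq_bigr => S _; rewrite ext_scaleE mulrCA.
Qed.

HB.instance Definition _ :=
  GRing.Lalgebra_isAlgebra.Build K (exterior K n) ext_scaleAr.

Definition ext_gen (i : 'I_n) : E := ext_mon [set i].

Lemma ext_mon_mul A B :
  ext_mon A * ext_mon B =
    if [disjoint A & B] then ext_sign A B *: ext_mon (A :|: B) else 0.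
Proof.
apply/ffunP => U; rewrite ext_mulE.
case: (boolP (A \subset U)) => [sAU|nAU].
  rewrite (bigD1 A) //= big1 ?addr0 => [|S /andP[_ SA]]; last first.
    by rewrite ffunE (negPf SA) mulr0 mul0r.
  rewrite !ffunE eqxx mulr1; case: ifP => dAB.
    rewrite ext_scaleE ffunE.
    suff -> : (U :\: A == B) = (U == A :|: B).
      case: eqP => [UE|_]; last by rewrite !mulr0.
      by rewrite UE setDUl setDv set0U (setDidPl _) // disjoint_sym.
    apply/eqP/eqP => [<-|->].
      by rewrite setDE setUIr setUCr setIT; apply/esym/setUidPr.
    by rewrite setDUl setDv set0U; apply/setDidPl; rewrite disjoint_sym.
  rewrite ext_zeroE (_ : (_ == B) = false) ?mulr0 //.
  apply: contraFF dAB => /eqP <-; rewrite -setI_eq0 setIDA setIC -setIDA.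
  by rewrite setDv setI0.
rewrite big1 => [|S sSU]; last first.
  rewrite ffunE (_ : (S == A) = false) ?mulr0 ?mul0r //.
  by apply: contraNF nAU => /eqP <-.
case: ifP => _; last by rewrite ext_zeroE.
rewrite ext_scaleE ffunE (_ : (U == _) = false) ?mulr0 //.
by apply: contraNF nAU => /eqP ->; apply: subsetUl.
Qed.

Lemma ext_gen_sqr i : ext_gen i * ext_gen i = 0.
Proof.
by rewrite ext_mon_mul disjoints1 inE eqxx.
Qed.

Lemma ext_gen_anticomm i j : ext_gen i * ext_gen j = - (ext_gen j * ext_gen i).
Proof.
have [->|nij] := eqVneq i j; first by rewrite ext_gen_sqr oppr0.
rewrite !ext_mon_mul !disjoints1 !inE nij eq_sym nij setUC -scaleNr.
congr (_ *: _); rewrite /ext_sign /ext_inv !big_set1.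
case: (ltngtP i j) => [||/val_inj eij]; rewrite ?expr0 ?expr1 ?opprK //.
by rewrite eij eqxx in nij.
Qed.

Lemma ext_mon_prod A : ext_mon A = \prod_(i <- enum A) ext_gen i.
Proof.
suff prodE (s : seq 'I_n) : sorted (relpre val ltn) s ->
    \prod_(i <- s) ext_gen i = ext_mon [set x in s].
  rewrite prodE; first by congr ext_mon; apply/setP => x; rewrite inE mem_enum.
  rewrite /enum_mem; apply: sorted_filter; first by move=> ? ? ?; apply: ltn_trans.
  by rewrite -enumT -sorted_map val_enum_ord iota_ltn_sorted.
elim: s => [_|i s IHs] /=.
  by rewrite big_nil; congr ext_mon; apply/setP => x; rewrite !inE.
rewrite path_sortedE => [/andP[/allP lis ss]|? ? ?]; last exact: ltn_trans.
have iNs : i \notin s by apply/negP => /lis /=; rewrite ltnn.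
rewrite big_cons IHs // ext_mon_mul disjoints1 inE iNs.
rewrite (_ : ext_sign _ _ = 1) ?scale1r.
  by congr ext_mon; apply/setP => x; rewrite !inE.
rewrite /ext_sign /ext_inv big_set1 big1 // => b; rewrite inE => /lis /=.
by move=> lib; rewrite ltnNge (ltnW lib).
Qed.

Definition ext_homog (d : nat) u : Prop :=
  forall S, u S != 0 -> #|S| = d.

(* The dual space of K^n is identified with E_1 via the coordinates x_i. *)
Definition linear_form (l : 'Hom('rV[K]_n, K^o)) : E :=
  \sum_(i < n) (l (delta_mx 0 i) : K) *: ext_gen i.

Definition vanishing_forms (W : {vspace 'rV[K]_n}) (u : E) : Prop :=
  exists2 l : 'Hom('rV[K]_n, K^o),
    (forall x : 'rV[K]_n, x \in W -> l x = 0) & u = linear_form l.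

Definition is_ideal (I : E -> Prop) : Prop :=
  [/\ I 0, forall u v, I u -> I v -> I (u + v)
    & forall a u b, I u -> I (a * u * b)].

Definition ideal_gen (G : E -> Prop) (u : E) : Prop :=
  forall I : E -> Prop, is_ideal I -> (forall g, G g -> I g) -> I u.

Definition intersection_ideal (t : nat) (W : 'I_t -> {vspace 'rV[K]_n})
    (u : E) : Prop :=
  forall i, ideal_gen (vanishing_forms (W i)) u.

Definition generated_in_degree_le (t : nat) (I : E -> Prop) : Prop :=
  forall u, I u <->
    ideal_gen (fun g => I g /\ exists2 d, (d <= t)%N & ext_homog d g) u.

(* Left modules F_i = \bigoplus_k E(- deg F i k), k < rank F i, written as    *)
(* row vectors; maps act by right multiplication, which is left E-linear.     *)
Record free_sequence := FreeSequence {
  rank : nat -> nat;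
  deg : forall i, 'I_(rank i) -> nat;
  diff : forall i, 'M[E]_(rank i.+1, rank i);
  aug : 'cV[E]_(rank 0)
}.

Definition free_homog (b : nat) (d : 'I_b -> nat) (j : nat) (v : 'rV[E]_b) :=
  forall k S, v 0 k S != 0 -> (#|S| + d k)%N = j.

Definition graded_free_resolution (F : free_sequence) (I : E -> Prop) : Prop :=
  [/\ (forall i k, free_homog (@deg F i) (deg k) (row k (diff F i)))
        /\ (forall k, ext_homog (deg k) (aug F k 0)),
      forall u, I u <-> exists v : 'rV[E]_(rank F 0), u = (v *m aug F) 0 0,
      forall v : 'rV[E]_(rank F 0),
        v *m aug F = 0 <-> exists w : 'rV[E]_(rank F 1), v = w *m diff F 0
    & forall i (v : 'rV[E]_(rank F i.+1)),
        v *m diff F i = 0 <->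
        exists w : 'rV[E]_(rank F i.+2), v = w *m diff F i.+1].

(* The differentials of F tensored over E with K = E / (x_1, ..., x_n): the   *)
(* quotient map E -> K takes the coefficient of x_set0 = 1.                   *)
Definition diff_tensK (F : free_sequence) i : 'M[K]_(rank F i.+1, rank F i) :=
  map_mx (fun u : E => u set0) (diff F i).

Definition tensK_cycle (F : free_sequence) (i : nat) :
    'rV[K]_(rank F i) -> Prop :=
  if i is i'.+1 then fun z => z *m diff_tensK F i' = 0 else fun=> True.

(* The degree j part of H_i (F (x)_E K) vanishes; when F is a graded free     *)
(* resolution of I, this homology is Tor_i^E(I, K)_j.                         *)
Definition tor_vanishes (F : free_sequence) (i j : nat) : Prop :=
  forall v : 'rV[K]_(rank F i),
    (forall k, v 0 k != 0 -> deg k = j) -> tensK_cycle v ->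
    exists w : 'rV[K]_(rank F i.+1), v = w *m diff_tensK F i.

(* Tor does not depend on the resolution, so it is required to vanish for all *)
(* of them; the first conjunct rules out vacuous truth.                       *)
Definition cm_regular (t : nat) (I : E -> Prop) : Prop :=
  (exists F, graded_free_resolution F I) /\
  (forall F, graded_free_resolution F I ->
     forall i j, (i + t < j)%N -> tor_vanishes F i j).

End Exterior.

(* Main.v *)
(* Let J_1, ..., J_t be ideals generated by linear forms and I their
   intersection. In a polynomial ring, following Derksen and Sidman, a generic
   linear form x is a nonzerodivisor modulo I + L in degrees >= t, for every
   ideal L generated by linear forms; by induction on the number of linear forms
   not in L this makes the Koszul homology of P / (I + L) vanish in the strands
   >= t.

   In characteristic zero this passes to the exterior algebra by polarization:
   an element of D (x) E, where D (x) - is the complex computing Tor over E, is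
   moved one degree at a time into polynomial copies ("slots") of the
   coordinates by odd derivations commuting with the differentials and
   preserving the ideals, and it is recovered up to a nonzero integer by the
   opposite derivations. So D (x) I is acyclic in the strands > t, and dimension
   shifting along a free resolution gives the vanishing of Tor. *)

Require Import Defs.
From HB Require Import structures.
From mathcomp Require Import all_boot all_order all_algebra.
From mathcomp Require Import boolp functions.

Set Implicit Arguments.
Unset Strict Implicit.
Unset Printing Implicit Defensive.

Import GRing.Theory.
Local Open Scope ring_scope.

(** * Vector spaces *)

(** Every linear form squares to zero in $E$, so none is a nonzerodivisor and the argument by
    generic forms cannot run there; this forces the detour through commuting variables. A derivation
    into a slot is undone, up to a factor, only on elements that do not yet involve that slot, so
    every unit of degree gets a slot of its own. The number of slots does not spoil the bound: the
    copies of the forms of one $J_i$ in all slots generate a single linear ideal, so there are still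
    t ideals. The number t itself is the price of removing the ideals from the intersection one by
    one, each removal costing one degree. Characteristic zero enters through the avoidance of
    finitely many proper subspaces, through division by degrees in Euler's identity and in undoing
    polarization, and through the factorials relating powers to divided powers. Koszul variables
    have the parity opposite to that of their coordinates; those of the odd coordinates are even,
    hence the divided powers in the complex for Tor. *)

Section VectorSpaces.
Variables (K : fieldType) (char0 : [pchar K] =i pred0).


Lemma natr_eq0 (d : nat) : (d%:R == 0 :> K) = (d == 0)%N.
Proof. by move/pcharf0P: char0 => ->. Qed.

(** If [x] lies in [U] but in no member of [r], and [y] is outside [U], then no [y + c x] lies in
    [U], and each member of [r] contains at most one of them. In characteristic zero the integers
    [c] provide more candidates than there are members. *)
Lemma avoid_subspaces (V : vectType K) (r : seq {vspace V}) :
  (forall U, U \in r -> U != fullv) -> exists x, forall U, U \in r -> x \notin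
    U.
Proof.
elim: r => [|U r IHr] pr; first by exists 0.
have [|x xr] := IHr; first by move=> U' U'r; apply: pr; rewrite inE U'r orbT.
have [xU|xU] := boolP (x \in U); last first.
  by exists x => U'; rewrite inE => /predU1P[->|/xr].
have [y yU] : exists y, y \notin U.
  have /subvPn[y _ yU] : ~~ (fullv <= U)%VS.
    by apply: contra (pr U (mem_head _ _)) => fU; rewrite eqEsubv subvf.
  by exists y.
suff [c cr] : exists c : 'I_(size r).+1,
    forall U', U' \in r -> y + c%:R *: x \notin U'.
  exists (y + c%:R *: x) => U'; rewrite inE => /predU1P[->|/cr//].
  by apply: contra yU => yxU; rewrite -(addrK (c%:R *: x) y) rpredB ?rpredZ.
have [/existsP[c /allP]|] := boolP [exists c : 'I_(size r).+1,
    all (fun U' : {vspace V} => y + c%:R *: x \notin U') r]; first by exists c.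
rewrite negb_exists => /forallP /= h.
have /fin_all_exists[g gP] (c : 'I_(size r).+1) :
    exists j : 'I_(size r), y + c%:R *: x \in (nth U r j : {vspace V}).
  have := h c; rewrite -has_predC => /(has_nthP U)[j jr]; rewrite /= negbK.
  by exists (Ordinal jr).
have /injectivePn[c [c' cc' gc]] : ~~ injectiveb g.
  apply/negP => /injectiveP/leq_card; rewrite !card_ord ltnn //.
have mem_r : nth U r (g c) \in r by apply: mem_nth.
have: (c%:R - c'%:R) *: x \in (nth U r (g c) : {vspace V}).
  have -> : (c%:R - c'%:R) *: x = (y + c%:R *: x) - (y + c'%:R *: x).
    by rewrite scalerBl opprD addrACA subrr add0r.
  by rewrite rpredB ?gP // gc gP.
have nz : c%:R - c'%:R != 0 :> K.
  wlog lecc : c c' cc' gc mem_r / (c' <= c)%N => [hw|].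
    case/orP: (leq_total c' c) => [|/hw {}hw]; first exact: hw.
    by rewrite -oppr_eq0 opprB hw // ?gc // 1?eq_sym // -gc.
  rewrite -natrB // natr_eq0 subn_eq0 -ltnNge ltn_neqAle lecc andbT eq_sym.
  exact: cc'.
by rewrite rpredZeq (negPf nz) /= (negPf (xr _ mem_r)).
Qed.

Lemma codim_addv_line (V : vectType K) (U : {vspace V}) v : v \notin U ->
  (\dim {:V} - \dim (U + <[v]>) < \dim {:V} - \dim U)%N.
Proof.
move=> vU; apply: ltn_sub2l.
  rewrite ltn_neqAle dimvS ?subvf // andbT; apply: contra vU => dU.
  have -> : U = fullv by apply/eqP; rewrite eqEdim subvf (eqP dU) /=.
  exact: memvf.
rewrite ltn_neqAle dimvS ?addvSl // andbT; apply: contra vU => dU.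
have -> : U = (U + <[v]>)%VS by apply/eqP; rewrite eqEdim addvSl (eqP dU) /=.
by apply: (subvP (addvSr _ _)); apply: memv_line.
Qed.

(** Project along [U] and take a coordinate in which the image of [x] is nonzero, rescaled. *)
Lemma functional_separation (X : finType) (U : {vspace {ffun X -> K^o}})
    (x : {ffun X -> K^o}) : x \notin U ->
  exists l : {ffun X -> K}, (forall v : {ffun X -> K^o}, v \in U -> \sum_i v i
    * l i = 0) /\
    \sum_i x i * l i = 1.
Proof.
move=> xU; pose q v : {ffun X -> K^o} := v - projv U v.
have qlin : linear q.
  by move=> a u v; rewrite /q linearP scalerBr opprD addrACA.
pose qL := GRing.isLinear.Build _ _ _ _ q qlin.
pose qq : {linear {ffun X -> K^o} -> {ffun X -> K^o}} := HB.pack q qL.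
have qx : q x != 0.
  by apply: contra xU; rewrite subr_eq0 => /eqP ->; rewrite memv_proj.
have [j qxj] : exists j, q x j != 0.
  apply/existsP; apply: contraR qx; rewrite negb_exists => /forallP h.
  by apply/eqP/ffunP => j; have := h j; rewrite negbK => /eqP ->; rewrite ffunE.
pose del i : {ffun X -> K^o} := [ffun k => (k == i)%:R].
have sumE (v : {ffun X -> K^o}) : \sum_i v i * (q (del i) j / q x j) = q v j /
  q x j.
  have {2}-> : v = \sum_i (v i : K) *: del i.
    apply/ffunP => k; rewrite sum_ffunE (bigD1 k) //= big1 ?addr0 => [|i ik].
      by rewrite !ffunE eqxx /= /GRing.scale /= mulr1.
    by rewrite !ffunE eq_sym (negPf ik) /= scaler0.
  rewrite -[q (\sum_i _)]/(qq _) linear_sum sum_ffunE mulr_suml.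
  by apply: eq_bigr => i _; rewrite linearZ !ffunE /= /GRing.scale /= mulrA.
exists [ffun i => q (del i) j / q x j]; split => [v vU|].
  under eq_bigr => i _ do rewrite ffunE.
  by rewrite sumE /q projv_id // subrr ffunE mul0r.
under eq_bigr => i _ do rewrite ffunE.
by rewrite sumE divff.
Qed.

End VectorSpaces.

(** * Intersections of linear ideals in polynomial modules *)

(* W is a module over the polynomial ring in the variables z i, with partial
   derivatives D i and degree projections ph, tensored with an exterior algebra
   on which e i and c i act by multiplication and contraction. *)
Section LinearIdeals.
Variables (K : fieldType) (char0 : [pchar K] =i pred0).
Variables (X : finType) (W : lmodType K).
Notation V := {ffun X -> K^o}.
Variables (z D e c : X -> {linear W -> W}) (ph : nat -> {linear W -> W}).
Hypothesis zC : forall i j w, z i (z j w) = z j (z i w).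
Hypothesis Dz : forall i j w, D i (z j w) = z j (D i w) + (i == j)%:R *: w.
Hypothesis ez : forall i j w, e i (z j w) = z j (e i w).
Hypothesis cz : forall i j w, c i (z j w) = z j (c i w).
Hypothesis ce : forall i j w, c i (e j w) + e j (c i w) = (i == j)%:R *: w.
Hypothesis cC : forall i j w, c i (c j w) = - c j (c i w).
Hypothesis ph0z : forall i w, ph 0 (z i w) = 0.
Hypothesis phSz : forall d i w, ph d.+1 (z i w) = z i (ph d w).
Hypothesis Dph0 : forall i w, D i (ph 0 w) = 0.
Hypothesis DphS : forall d i w, D i (ph d.+1 w) = ph d (D i w).
Hypothesis phc : forall d i w, ph d (c i w) = c i (ph d w).
Hypothesis phK : forall d w, ph d (ph d w) = ph d w.
Hypothesis euler : forall d w,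
  \sum_i z i (D i (ph d w)) = d%:R *: ph d w.

Definition lin (v : V) (w : W) : W := \sum_i (v i : K) *: z i w.

Fact lin_is_linear v : linear (lin v).
Proof.
move=> a w w'; rewrite /lin scaler_sumr -big_split /=; apply: eq_bigr => i _.
by rewrite linearP scalerDr !scalerA mulrC.
Qed.
HB.instance Definition _ v := GRing.isLinear.Build K W W _ (lin v)
  (lin_is_linear v).

Lemma linDl u v w : lin (u + v) w = lin u w + lin v w.
Proof.
by rewrite /lin -big_split /=; apply: eq_bigr => i _; rewrite ffunE scalerDl.
Qed.

Lemma linZl a v w : lin (a *: v) w = a *: lin v w.
Proof.
rewrite /lin scaler_sumr; apply: eq_bigr => i _.
by rewrite ffunE scalerA.
Qed.

Lemma lin0l w : lin 0 w = 0.
Proof. by rewrite /lin big1 // => i _; rewrite ffunE scale0r. Qed.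

Lemma lin_suml (I : Type) (r : seq I) (P : pred I) (F : I -> V) w :
  lin (\sum_(i <- r | P i) F i) w = \sum_(i <- r | P i) lin (F i) w.
Proof.
by elim/big_rec2: _ => [|i x y _ <-]; rewrite ?lin0l // linDl.
Qed.

Lemma linz v i w : lin v (z i w) = z i (lin v w).
Proof.
by rewrite /lin linear_sum; apply: eq_bigr => j _; rewrite linearZ zC.
Qed.

Lemma linC u v w : lin u (lin v w) = lin v (lin u w).
Proof.
rewrite {2}/lin linear_sum; apply: eq_bigr => j _.
by rewrite linearZ /= linz.
Qed.

Lemma ph0lin v w : ph 0 (lin v w) = 0.
Proof.
by rewrite linear_sum big1 // => i _; rewrite linearZ /= ph0z scaler0.
Qed.

Lemma phSlin d v w : ph d.+1 (lin v w) = lin v (ph d w).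
Proof.
by rewrite linear_sum; apply: eq_bigr => i _; rewrite linearZ /= phSz.
Qed.

(** The submodule $L W$, built by adjoining one multiple at a time, so that stability under an
    operator is checked on the generators [lin v q] only. *)
Inductive lid (L : {vspace V}) : W -> Prop :=
| lid0 : lid L 0
| lidD w v q : lid L w -> v \in L -> lid L (w + lin v q).

Lemma lid_lin (L : {vspace V}) v q : v \in L -> lid L (lin v q).
Proof. by move=> vL; rewrite -[lin v q]add0r; apply: lidD => //;
  apply: lid0. Qed.

Lemma lid_add (L : {vspace V}) w w' : lid L w -> lid L w' -> lid L (w + w').
Proof.
move=> lw; elim=> [|u v q _ IH vL]; first by rewrite addr0.
by rewrite addrA; apply: lidD.
Qed.

Lemma lid_map (L L' : {vspace V}) (f : {linear W -> W}) :
  (forall v q, v \in L -> lid L' (f (lin v q))) ->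
  forall w, lid L w -> lid L' (f w).
Proof.
move=> fL w; elim=> [|u v q _ IH vL]; first by rewrite linear0; apply: lid0.
by rewrite linearD; apply: lid_add IH (fL _ _ vL).
Qed.

Lemma lid_scale (L : {vspace V}) a w : lid L w -> lid L (a *: w).
Proof.
apply: (lid_map (f := a \*: idfun)) => v q vL /=.
by rewrite -linearZ /=; apply: lid_lin.
Qed.

Lemma lid_lin_stable (L : {vspace V}) v w : lid L w -> lid L (lin v w).
Proof.
apply: lid_map => u q uL.
by rewrite /= linC; apply: lid_lin.
Qed.

Lemma lid_sum (L : {vspace V}) (I : Type) (r : seq I) (F : I -> W) :
  (forall i, lid L (F i)) -> lid L (\sum_(i <- r) F i).
Proof.
by move=> FL; elim/big_ind: _ => [|? ?|//]; [apply: lid0|apply: lid_add].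
Qed.

Lemma lid_ph (L : {vspace V}) d w : lid L w -> lid L (ph d w).
Proof.
apply: lid_map => v q vL; case: d => [|d].
  by rewrite ph0lin; apply: lid0.
by rewrite phSlin; apply: lid_lin.
Qed.

Definition homog d w := ph d w = w.

(** Euler's identity divided by the degree. It settles the base case of the inductions on the
    codimension of [L]. *)
Lemma homog_pos_lid d w : homog d.+1 w -> lid fullv w.
Proof.
move=> hw; have := euler d.+1 w; rewrite hw => Ew.
have -> : w = d.+1%:R^-1 *: (\sum_i z i (D i w)).
  by rewrite Ew scalerA mulVf ?scale1r // natr_eq0.
apply/lid_scale/lid_sum => i.
have -> : z i (D i w) = lin [ffun j => (j == i)%:R] (D i w).
  rewrite /lin (bigD1 i) //= big1 ?addr0 => [|j ji];
    rewrite ffunE ?eqxx ?scale1r //.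
  by rewrite (negPf ji) scale0r.
by apply: lid_lin; apply: memvf.
Qed.

Variables (T : finType) (S : T -> {vspace V}).
Implicit Types (A B : {set T}) (L : {vspace V}).

Definition lcap A w := forall k, k \in A -> lid (S k) w.
Definition lmix A L w := exists p q, [/\ lcap A p, lid L q & w = p + q].

Lemma lmix_capl A L w : lcap A w -> lmix A L w.
Proof. by exists w, 0; split; rewrite ?addr0 //; apply: lid0. Qed.

Lemma lmix_lidr A L w : lid L w -> lmix A L w.
Proof. by exists 0, w; split; rewrite ?add0r // => k _; apply: lid0. Qed.

Lemma lmix_map A A' L L' (f : {linear W -> W}) :
  (forall w, lcap A w -> lcap A' (f w)) -> (forall w, lid L w -> lid L' (f w))
    ->
  forall w, lmix A L w -> lmix A' L' (f w).
Proof.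
move=> fA fL w [p [q [pA qL ->]]]; rewrite linearD.
by exists (f p), (f q); split; auto.
Qed.

Lemma lmix_add A L w w' : lmix A L w -> lmix A L w' -> lmix A L (w + w').
Proof.
move=> [p [q [pA qL ->]]] [p' [q' [pA' qL' ->]]]; rewrite addrACA.
exists (p + p'), (q + q'); split=> //; last exact: lid_add.
by move=> k kA; apply: lid_add; auto.
Qed.

Lemma lmix_scale A L a w : lmix A L w -> lmix A L (a *: w).
Proof.
apply: (lmix_map (f := a \*: idfun)) => {}w /=; last exact: lid_scale.
by move=> wA k kA; apply/lid_scale/wA.
Qed.

Lemma lmix_sub A L w w' : lmix A L w -> lmix A L w' -> lmix A L (w - w').
Proof. by move=> mw mw'; rewrite -scaleN1r; apply/lmix_add/lmix_scale. Qed.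

Lemma lmix_sum A L (I : Type) (r : seq I) (P : pred I) (F : I -> W) :
  (forall i, P i -> lmix A L (F i)) -> lmix A L (\sum_(i <- r | P i) F i).
Proof.
move=> FL; elim/big_ind: _ => [|? ?|i]; last exact: FL.
  by apply: lmix_lidr; apply: lid0.
exact: lmix_add.
Qed.

Lemma lmix_lin A L v w : lmix A L w -> lmix A L (lin v w).
Proof.
apply: lmix_map => {}w; last exact: lid_lin_stable.
by move=> wA k kA; apply/lid_lin_stable/wA.
Qed.

Lemma lmix_subset A B L w : B \subset A -> lmix A L w -> lmix B L w.
Proof.
move=> /subsetP BA [p [q [pA qL ->]]]; exists p, q; split=> // k kB.
exact/pA/BA.
Qed.

Lemma lmix_linD1 A L k v w :
  v \in S k -> lmix (A :\ k) L w -> lmix A L (lin v w).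
Proof.
move=> vS; apply: lmix_map => {}w; last exact: lid_lin_stable.
move=> wA j jA; have [->|jk] := eqVneq j k; first exact: lid_lin.
by apply/lid_lin_stable/wA; rewrite !inE jk.
Qed.

Lemma lmix_set0 L w : lmix set0 L w.
Proof. by apply: lmix_capl => k; rewrite inE. Qed.

Definition forms A : {vspace V} := (\sum_(k in A) S k)%VS.

(** All subsets [B] are included so that genericity survives the removal of a subspace from [A]. *)
Definition generic A L x := forall B, B \subset A ->
  (forms B + L)%VS != fullv -> x \notin (forms B + L)%VS.

Lemma generic_exists A L : exists x, generic A L x.
Proof.
pose r := [seq (forms B + L)%VS | B <- enum (powerset A)].
have [|x xr] := avoid_subspaces char0 (r := [seq U <- r | U != fullv]).
  by move=> U; rewrite mem_filter => /andP[].
exists x => B BA Bf; apply: xr; rewrite mem_filter Bf.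
by apply: (map_f (fun B => (forms B + L)%VS)); rewrite mem_enum powersetE.
Qed.

Lemma generic_subset A B L x : B \subset A -> generic A L x -> generic B L x.
Proof. by move=> BA gx C CB; apply/gx/(subset_trans CB). Qed.

(** Split [v] into one form from each [S k] and one from [L]: the form from [S k] supplies
    membership in the one ideal that the hypothesis on [w] leaves out. *)
Lemma lmix_lin_full A L w : (forms A + L)%VS = fullv ->
  (forall k, k \in A -> lmix (A :\ k) L w) -> forall v, lmix A L (lin v w).
Proof.
move=> fA wA v; have: v \in (forms A + L)%VS by rewrite fA memvf.
case/memv_addP => v1 v1A [v2 v2L ->]; rewrite linDl; apply: lmix_add;
  last first.
  exact/lmix_lidr/lid_lin.
case/memv_sumP: v1A => u uS ->; rewrite lin_suml; apply: lmix_sum => k kA.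
by apply: lmix_linD1 (wA k kA); apply: uS.
Qed.

Definition deriv (l : {ffun X -> K}) (w : W) : W := \sum_i l i *: D i w.
Fact deriv_is_linear l : linear (deriv l).
Proof.
move=> a w w'; rewrite /deriv scaler_sumr -big_split /=; apply: eq_bigr => i _.
by rewrite linearP scalerDr !scalerA mulrC.
Qed.
HB.instance Definition _ l :=
  GRing.isLinear.Build K W W _ (deriv l) (deriv_is_linear l).

Lemma D_lin i v w : D i (lin v w) = lin v (D i w) + (v i : K) *: w.
Proof.
rewrite linear_sum /= /lin.
have -> : (v i : K) *: w = \sum_j (v j : K) *: ((i == j)%:R *: w).
  rewrite (bigD1 i) //= eqxx scale1r big1 ?addr0 // => j ji.
  by rewrite eq_sym (negPf ji) scale0r scaler0.
by rewrite -big_split; apply: eq_bigr => j _; rewrite linearZ /= Dz scalerDr.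
Qed.

Lemma deriv_lin l v w :
  deriv l (lin v w) = lin v (deriv l w) + (\sum_i v i * l i) *: w.
Proof.
rewrite scaler_suml /deriv [lin v (\sum_i _)]linear_sum -big_split.
apply: eq_bigr => i _ /=; rewrite D_lin scalerDr scalerA [l i * _]mulrC.
by rewrite [lin v (_ *: _)]linearZ.
Qed.

Lemma lid_deriv L (l : {ffun X -> K}) w :
  (forall v : V, v \in L -> \sum_i v i * l i = 0) -> lid L w -> lid L (deriv l
    w).
Proof.
move=> lL; apply: lid_map => v q vL.
by rewrite /= deriv_lin lL // scale0r addr0; apply: lid_lin.
Qed.

Lemma homog_deriv d l w : homog d.+1 w -> homog d (deriv l w).
Proof.
move=> hw; rewrite /homog linear_sum; apply: eq_bigr => i _.
by rewrite linearZ /= -DphS hw.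
Qed.

(** The derivative along a functional that kills [forms A + L] and is 1 at [x] preserves all the
    ideals and sends $x f$ to $x f' + f$. It is nilpotent on [f], so one descends from the vanishing
    derivative back to [f]. *)
Lemma lmix_regular_away A L x d f : x \notin (forms A + L)%VS -> homog d f ->
  lmix A L (lin x f) -> lmix A L f.
Proof.
move=> xA hf mxf.
have [l [lA lx]] := functional_separation xA.
have mderiv w : lmix A L w -> lmix A L (deriv l w).
  apply: lmix_map => {}w wA; last first.
    apply: lid_deriv wA => v vL; apply: lA.
    by apply: subvP vL; apply: addvSr.
  move=> k kA; apply: lid_deriv (wA k kA) => v vS; apply: lA.
  apply: (subvP (addvSl _ _)); apply: subvP vS.
  by rewrite /forms (bigD1 k) //= addvSl.
pose g r := iter r (deriv l) f.
(* This is the derivative of order [r] of $x f$; at [r = 0] the coefficient 0 makes the truncated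
   [r.-1] harmless. *)
have gr r : lmix A L (lin x (g r) + r%:R *: g r.-1).
  elim: r => [|r /mderiv]; first by rewrite scale0r addr0.
  rewrite linearD linearZ /= deriv_lin lx scale1r -addrA.
  case: r => [|r]; first by rewrite scale0r addr0 scale1r.
  by rewrite -[r.+2%:R]natr1 scalerDl scale1r [r.+1%:R *: g _ + _]addrC.
have g0 : g d.+1 = 0.
  suff: homog 0 (g d) /\ g d.+1 = 0 by case.
  have hg r : (r <= d)%N -> homog (d - r) (g r).
    elim: r => [|r IHr] rd; first by rewrite subn0.
    by apply: homog_deriv; rewrite subnSK //; apply/IHr/ltnW.
  have := hg d (leqnn d); rewrite subnn => h0; split=> //.
  by rewrite /g iterS -/(g d) -h0 /deriv big1 // => i _; rewrite Dph0 scaler0.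
suff gk k : (k <= d.+1)%N -> lmix A L (g (d.+1 - k)%N).
  by have := gk d.+1 (leqnn _); rewrite subnn.
elim: k => [_|k IHk kd]; first by rewrite subn0 g0; apply/lmix_lidr/lid0.
have /lmix_sub := gr (d.+1 - k)%N; move=> /(_ _ (lmix_lin x (IHk (ltnW kd)))).
rewrite addrC addKr -subnS subSn // => /(lmix_scale (d - k).+1%:R^-1).
by rewrite scalerA mulVf ?scale1r // natr_eq0.
Qed.

Lemma lid_addv_line L x w :
  lid (L + <[x]>)%VS w -> exists q g, lid L q /\ w = q + lin x g.
Proof.
elim=> [|u v q _ [p [g [pL ->]]] /memv_addP[v1 v1L [v2 /vlineP[a ->] ->]]].
  by exists 0, 0; split; [apply: lid0|rewrite linear0 addr0].
exists (p + lin v1 q), (g + a *: q); split; first exact/lid_add/lid_lin.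
by rewrite linDl linZl linearD linearZ /= addrACA.
Qed.

Lemma lmix_addv_line A L x d f : homog d.+1 f -> lmix A (L + <[x]>)%VS f ->
  exists p g, [/\ lmix A L p, homog d g & f = p + lin x g].
Proof.
move=> hf [p [q [pA /lid_addv_line[q' [g [q'L ->]]] fE]]].
exists (ph d.+1 (p + q')), (ph d g); split; last 1 first.
- by rewrite -hf fE addrA linearD /= phSlin.
- rewrite linearD; apply: lmix_add; last exact/lmix_lidr/lid_ph.
  by apply: lmix_capl => k kA; apply/lid_ph/pA.
- exact: phK.
Qed.

(* If the forms vanishing on the subspaces of A span everything modulo L, then
   x f in lmix A L implies V f in lmix A L, by induction on A. Modulo x this
   gives f = p + x g with p in lmix A L, and then V g in lmix A L in turn. *)
Lemma lmix_regular A L x d f : generic A L x -> (#|A| <= d)%N -> homog d f ->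
  lmix A L (lin x f) -> lmix A L f.
Proof.
have [a Aa] := ubnP #|A|; elim: a => // a IHa in A L x d f Aa *.
have [r Lr] := ubnP (\dim {:V} - \dim L); elim: r => // r IHr in L x d f Lr *.
move=> gx Ad hf mxf.
have [->|A0] := eqVneq A set0; first exact: lmix_set0.
have [fA|nfA] := eqVneq (forms A + L)%VS fullv; last first.
  exact: lmix_regular_away (gx A (subxx _) nfA) hf mxf.
case: d => [|d] in Ad hf *; first by rewrite leqn0 cards_eq0 (negPf A0) in Ad.
have [Lf|nLf] := eqVneq L fullv.
  by apply: lmix_lidr; rewrite Lf; apply: homog_pos_lid hf.
have xL : x \notin L.
  have := gx set0 (sub0set _); rewrite /forms big_set0 add0v; exact.
have cardD1 k : k \in A -> (#|A :\ k| <= d)%N /\ (#|A :\ k| < a)%N.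
  by move=> kA; move: Ad Aa; rewrite (cardsD1 k A) kA.
(* Removing [k] lowers the required degree by one, so the induction hypothesis covers both [f] and a
   quotient of [f] by [x], which has one degree less. *)
have AkP k g : k \in A -> homog d.+1 g \/ homog d g ->
    lmix (A :\ k) L (lin x g) -> lmix (A :\ k) L g.
  move=> kA hg; have [Akd Aka] := cardD1 k kA.
  have gk := generic_subset (subsetDl A [set k]) gx.
  by case: hg => hg; apply: IHa hg; rewrite // ltnW.
have mVf v : lmix A L (lin v f).
  apply: lmix_lin_full => // k kA; apply: (AkP k); auto.
  exact: lmix_subset (subsetDl _ _) mxf.
(* Since [x] vanishes modulo [L + <[x]>], the induction on the codimension needs a new generic
   form. *)
have [y gy] := generic_exists A (L + <[x]>)%VS.
have LL' w : lmix A L w -> lmix A (L + <[x]>)%VS w.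
  move=> [p [q [pA qL ->]]]; exists p, q; split=> //.
  apply: (lid_map (f := idfun) _ qL) => v q' vL; apply: lid_lin.
  by apply: subvP vL; apply: addvSl.
have: lmix A (L + <[x]>)%VS f.
  apply: IHr gy Ad hf (LL' _ (mVf y)).
  by rewrite -ltnS (leq_trans _ Lr) // ltnS codim_addv_line.
case/(lmix_addv_line hf) => p [g [pM hg fE]].
rewrite fE; apply: lmix_add => //.
apply: lmix_lin_full => // k kA; apply: (AkP k); auto.
have -> : lin x g = f - p by rewrite fE addrC addKr.
apply: lmix_sub; last exact: lmix_subset (subsetDl _ _) pM.
apply: (AkP k); auto.
exact: lmix_subset (subsetDl _ _) mxf.
Qed.

(** * Koszul homology modulo an intersection of linear ideals *)

Definition koszul (w : W) : W := \sum_i z i (c i w).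
Fact koszul_is_linear : linear koszul.
Proof.
move=> a w w'; rewrite /koszul scaler_sumr -big_split /=; apply: eq_bigr => i _.
by rewrite !linearP.
Qed.
HB.instance Definition _ :=
  GRing.isLinear.Build K W W _ koszul koszul_is_linear.

Definition wedge (v : V) (w : W) : W := \sum_i (v i : K) *: e i w.
Fact wedge_is_linear v : linear (wedge v).
Proof.
move=> a w w'; rewrite /wedge scaler_sumr -big_split /=; apply: eq_bigr => i _.
by rewrite linearP scalerDr !scalerA mulrC.
Qed.
HB.instance Definition _ v :=
  GRing.isLinear.Build K W W _ (wedge v) (wedge_is_linear v).

Lemma koszul_lin v w : koszul (lin v w) = lin v (koszul w).
Proof.
rewrite /koszul [lin v (\sum_i _)]linear_sum; apply: eq_bigr => i _ /=.
rewrite linz; congr (z i _); rewrite linear_sum; apply: eq_bigr => j _.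
by rewrite linearZ /= cz.
Qed.

Lemma wedge_lin u v w : wedge u (lin v w) = lin v (wedge u w).
Proof.
rewrite /wedge [lin v (\sum_i _)]linear_sum; apply: eq_bigr => i _ /=.
rewrite [lin v (_ *: _)]linearZ; congr (_ *: _).
by rewrite linear_sum; apply: eq_bigr => j _; rewrite linearZ /= ez.
Qed.

Lemma lmix_commute A L (f : {linear W -> W}) w :
  (forall v u, f (lin v u) = lin v (f u)) -> lmix A L w -> lmix A L (f w).
Proof.
move=> fC; have fL L' u : lid L' u -> lid L' (f u).
  by apply: lid_map => v q vL; rewrite fC; apply: lid_lin.
by apply: lmix_map; [move=> u uA k kA; apply/fL/uA|exact: fL].
Qed.

(** The homotopy formula: multiplication by a linear form is null-homotopic on the Koszul
    complex. *)
Lemma koszul_wedge v w : koszul (wedge v w) + wedge v (koszul w) = lin v w.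
Proof.
rewrite /koszul /lin [wedge v (\sum_i _)]linear_sum -big_split.
apply: eq_bigr => i _ /=.
have -> : wedge v (z i (c i w)) = z i (wedge v (c i w)).
  rewrite /wedge linear_sum; apply: eq_bigr => j _.
  by rewrite linearZ /= ez.
rewrite -linearD -linearZ /=; congr (z i _).
rewrite /wedge linear_sum -big_split (bigD1 i) //= linearZ /= -scalerDr.
rewrite ce eqxx scale1r big1 ?addr0 // => j ji.
by rewrite linearZ /= -scalerDr ce eq_sym (negPf ji) scale0r scaler0.
Qed.

Lemma koszulK w : koszul (koszul w) = 0.
Proof.
have E : koszul (koszul w) = \sum_i \sum_j z i (z j (c i (c j w))).
  rewrite {1}/koszul; apply: eq_bigr => i _.
  rewrite linear_sum /= linear_sum; apply: eq_bigr => j _.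
  by rewrite /= cz.
have: koszul (koszul w) = - koszul (koszul w).
  rewrite {1}E exchange_big E -sumrN; apply: eq_bigr => i _.
  rewrite -sumrN; apply: eq_bigr => j _.
  by rewrite zC cC !linearN.
move/eqP; rewrite -subr_eq0 opprK -mulr2n -scaler_nat scaler_eq0.
by rewrite natr_eq0 // => /eqP.
Qed.

Lemma phSkoszul d w : ph d.+1 (koszul w) = koszul (ph d w).
Proof.
by rewrite linear_sum; apply: eq_bigr => i _; rewrite /= phSz phc.
Qed.

(** Induction on the codimension of [L]. Modulo a generic [x] the element [w] is a boundary, so $w$
    is a boundary plus $p + x g$ with $p$ in the ideal. Applying the differential and cancelling [x]
    puts the differential of [g] in the ideal, and the homotopy formula then makes $x g$ a boundary
    modulo the ideal. *)
Lemma koszul_acyclic A L j w : (#|A| <= j)%N -> homog j w ->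
  lmix A L (koszul w) -> exists b, lmix A L (w - koszul b).
Proof.
move=> Aj; have [r Lr] := ubnP (\dim {:V} - \dim L).
elim: r => // r IHr in L w Lr *; move=> hw mkw.
have [->|A0] := eqVneq A set0; first by exists 0; apply: lmix_set0.
case: j => [|j] in Aj hw IHr *;
  first by rewrite leqn0 cards_eq0 (negPf A0) in Aj.
have [Lf|nLf] := eqVneq L fullv.
  exists 0; rewrite linear0 subr0; apply: lmix_lidr.
  by rewrite Lf; apply: homog_pos_lid hw.
have [x gx] := generic_exists A L.
have xL : x \notin L.
  have := gx set0 (sub0set _); rewrite /forms big_set0 add0v; exact.
have [|//||b mb] := IHr (L + <[x]>)%VS w.
- by rewrite -ltnS (leq_trans _ Lr) // ltnS codim_addv_line.
- move: mkw => [p [q [pA qL ->]]]; exists p, q; split=> //.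
  apply: (lid_map (f := idfun) _ qL) => v q' vL; apply: lid_lin.
  by apply: subvP vL; apply: addvSl.
(* As [koszul] raises the polynomial degree by one, only the part of [b] of degree [j] can
   contribute to [w]. *)
have {mb} mb : lmix A (L + <[x]>)%VS (w - koszul (ph j b)).
  rewrite -phSkoszul -{1}hw -linearB; move: mb.
  by apply: lmix_map => u; [move=> uA k kA; apply/lid_ph/uA|apply: lid_ph].
have hwb : homog j.+1 (w - koszul (ph j b)).
  by rewrite /homog linearB /= hw phSkoszul phK.
have [p [g [pM hg wE]]] := lmix_addv_line hwb mb.
exists (ph j b + wedge x g).
(* Although [g] has degree [j] only, [koszul g] has degree [j.+1], where [x] may be cancelled. *)
have mkg : lmix A L (koszul g).
  apply: (lmix_regular gx Aj); first by rewrite /homog phSkoszul hg.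
  have -> : lin x (koszul g) = koszul w - koszul p.
    have := congr1 koszul wE; rewrite linearB linearD /= koszulK subr0 => ->.
    by rewrite koszul_lin addrC addKr.
  by apply: lmix_sub => //; apply: lmix_commute pM => v u;
    rewrite /= koszul_lin.
rewrite linearD opprD addrA /= wE -(koszul_wedge x g).
rewrite addrA addrAC addrK; apply: lmix_add => //.
by apply: lmix_commute mkg => v u; rewrite /= wedge_lin.
Qed.
End LinearIdeals.

(** * Polynomial and exterior variables *)

(* fock K O is the tensor product of a polynomial and an exterior algebra, both
   on variables indexed by O (more precisely, its completion); bp, bm are
   multiplication by and derivation along an even variable, fp, fm
   multiplication by and contraction with an odd one. *)
Section Fock.
Variables (K : fieldType) (O : finType) (lt : rel O).
Hypothesis ltxx : forall i, lt i i = false.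
Hypothesis ltN : forall i j, i != j -> lt i j = ~~ lt j i.
Notation mon := {ffun O -> nat}.
Definition fock := mon * {set O} -> K^o.
HB.instance Definition _ := GRing.Lmodule.on fock.
Implicit Types (f : fock) (m : mon) (S : {set O}) (i j : O).

Definition up i m : mon := [ffun j => (m j + (j == i))%N].
Definition dn i m : mon := [ffun j => (m j - (j == i))%N].

Lemma upK i m : dn i (up i m) = m.
Proof. by apply/ffunP => j; rewrite !ffunE addnK. Qed.
Lemma dnK i m : (0 < m i)%N -> up i (dn i m) = m.
Proof.
by move=> mi; apply/ffunP => j; rewrite !ffunE subnK //; case: eqP => // ->.
Qed.
Lemma upC i j m : up i (up j m) = up j (up i m).
Proof. by apply/ffunP => k; rewrite !ffunE addnAC. Qed.
Lemma dnC i j m : dn i (dn j m) = dn j (dn i m).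
Proof. by apply/ffunP => k; rewrite !ffunE subnAC. Qed.
Lemma updn i j m : i != j -> up i (dn j m) = dn j (up i m).
Proof.
move=> ij; apply/ffunP => k; rewrite !ffunE.
by case: (eqVneq k i) => [->|_]; rewrite ?(negPf ij) ?addn0 /= ?subn0.
Qed.

(** The sign of moving the odd variable [i] past the smaller variables in [S]. *)
Definition sg i S : K := (-1) ^+ #|[set j in S | lt j i]|.

Lemma sgD1 i j S : j \in S -> sg i S = sg i (S :\ j) * (-1) ^+ lt j i.
Proof.
move=> jS; rewrite /sg -exprD (cardsD1 j) !inE jS /= addnC;
  congr (_ ^+ (_ + _)).
by apply: eq_card => k; rewrite !inE andbA.
Qed.
Lemma sgU1 i j S : j \notin S -> sg i (j |: S) = sg i S * (-1) ^+ lt j i.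
Proof. by move=> jS; rewrite (sgD1 i (setU11 j S)) setU1K. Qed.
Lemma sgK i S : sg i S * sg i S = 1.
Proof. by rewrite /sg -expr2 sqrr_sign. Qed.
Lemma sgU1id i S : sg i (i |: S) = sg i S.
Proof.
have [iS|iS] := boolP (i \in S); last by rewrite sgU1 // ltxx mulr1.
by congr sg; apply/setUidPr; rewrite sub1set.
Qed.
Lemma sgD1id i S : sg i (S :\ i) = sg i S.
Proof.
have [iS|iS] := boolP (i \in S); first by rewrite (sgD1 i iS) ltxx mulr1.
by congr sg; apply/setDidPl; rewrite disjoint_sym disjoints1.
Qed.

Definition bp i f : fock := fun x =>
  if (0 < x.1 i)%N then f (dn i x.1, x.2) else 0.
Definition bm i f : fock := fun x => (x.1 i).+1%:R * f (up i x.1, x.2).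
Definition fp i f : fock := fun x =>
  if i \in x.2 then sg i x.2 * f (x.1, x.2 :\ i) else 0.
Definition fm i f : fock := fun x =>
  if i \in x.2 then 0 else sg i x.2 * f (x.1, i |: x.2).

Lemma fockP f g : (forall m S, f (m, S) = g (m, S)) -> f = g.
Proof. by move=> fg; apply/funext => -[m S]. Qed.
Lemma fockD f g x : (f + g) x = f x + g x. Proof. by []. Qed.
Lemma fockN f x : (- f) x = - f x. Proof. by []. Qed.
Lemma fockZ a f x : (a *: f) x = a * f x. Proof. by []. Qed.
Lemma fock0 x : (0 : fock) x = 0. Proof. by []. Qed.
Lemma fock_sum (I : Type) (r : seq I) (P : pred I) (F : I -> fock) x :
  (\sum_(i <- r | P i) F i) x = \sum_(i <- r | P i) F i x.
Proof. by elim/big_rec2: _ => // i y g _ <-. Qed.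

Fact bp_is_linear i : linear (bp i).
Proof.
move=> a f g; apply/funext => x; rewrite /bp !(fockD, fockZ).
by case: ifP; rewrite ?mulr0 ?addr0.
Qed.
Fact bm_is_linear i : linear (bm i).
Proof.
move=> a f g; apply/funext => x; rewrite /bm !(fockD, fockZ).
by rewrite mulrDr mulrCA.
Qed.
Fact fp_is_linear i : linear (fp i).
Proof.
move=> a f g; apply/funext => x; rewrite /fp !(fockD, fockZ).
by case: ifP; rewrite ?mulr0 ?addr0 // mulrDr mulrCA.
Qed.
Fact fm_is_linear i : linear (fm i).
Proof.
move=> a f g; apply/funext => x; rewrite /fm !(fockD, fockZ).
by case: ifP; rewrite ?mulr0 ?addr0 // mulrDr mulrCA.
Qed.
HB.instance Definition _ i := GRing.isLinear.Build K fock fock _ (bp i)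
  (bp_is_linear i).
HB.instance Definition _ i := GRing.isLinear.Build K fock fock _ (bm i)
  (bm_is_linear i).
HB.instance Definition _ i := GRing.isLinear.Build K fock fock _ (fp i)
  (fp_is_linear i).
HB.instance Definition _ i := GRing.isLinear.Build K fock fock _ (fm i)
  (fm_is_linear i).

(** * Commutation and anticommutation relations *)

Lemma bpC i j f : bp i (bp j f) = bp j (bp i f).
Proof.
have [->//|ij] := eqVneq i j.
apply: fockP => m S; rewrite /bp /= !ffunE (negPf ij) eq_sym (negPf ij) !subn0.
by rewrite dnC; case: ifP; case: ifP.
Qed.

Lemma bmC i j f : bm i (bm j f) = bm j (bm i f).
Proof.
have [->//|ij] := eqVneq i j.
apply: fockP => m S; rewrite /bm /= !ffunE (negPf ij) eq_sym (negPf ij) !addn0.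
by rewrite upC mulrCA.
Qed.

Lemma bm_bp i j f : bm i (bp j f) = bp j (bm i f) + (i == j)%:R *: f.
Proof.
apply: fockP => m S; rewrite fockD fockZ /bm /bp /= !ffunE.
have [->|ij] := eqVneq i j.
  rewrite addn1 upK subn1 /=; case: ifP => mi.
    by rewrite dnK // prednK // -natr1 mulrDl.
  by move/negbT: mi; rewrite lt0n negbK => /eqP ->; rewrite add0r.
rewrite addn0 mul0r addr0 subn0 updn //.
by case: ifP => _; rewrite ?mulr0.
Qed.

Lemma fpC i j f : fp i (fp j f) = - fp j (fp i f).
Proof.
apply: fockP => m S; rewrite fockN /fp /= !inE.
have [->|ij] := eqVneq i j; first by case: ifP; rewrite /= ?mulr0 oppr0.
rewrite /=; case: ifP => iS; case: ifP => jS; rewrite ?mulr0 ?oppr0 //.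
rewrite (sgD1 i jS) (sgD1 j iS) setDDl setUC -setDDl.
rewrite (ltN ij); case: (lt j i) => /=;
  rewrite !(expr0, expr1, mulr1, mulrN, mulNr, opprK) //.
  by rewrite mulrCA.
by rewrite mulrCA.
Qed.

Lemma fmC i j f : fm i (fm j f) = - fm j (fm i f).
Proof.
apply: fockP => m S; rewrite fockN /fm /= !inE.
have [->|ij] := eqVneq i j; first by case: ifP; rewrite /= ?mulr0 oppr0.
rewrite /=; case: ifP => iS; case: ifP => jS; rewrite ?mulr0 ?oppr0 //.
rewrite (sgU1 j (negbT iS)) (sgU1 i (negbT jS)) setUCA.
rewrite (ltN ij); case: (lt j i) => /=;
  rewrite !(expr0, expr1, mulr1, mulrN, mulNr, opprK) //.
  by rewrite mulrCA.
by rewrite mulrCA.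
Qed.

Lemma fm_fp i j f : fm i (fp j f) + fp j (fm i f) = (i == j)%:R *: f.
Proof.
apply: fockP => m S; rewrite fockD fockZ /fm /fp /= !inE.
have [->|ij] := eqVneq i j.
  rewrite /=; case: ifP => jS.
    by rewrite sgD1id setD1K // mulrA sgK !mul1r add0r.
  by rewrite sgU1id setU1K ?jS // mulrA sgK !mul1r addr0.
rewrite /= mul0r.
case: ifP => iS; case: ifP => jS; rewrite ?mulr0 ?addr0 ?add0r //.
rewrite (sgD1 i jS) sgU1 ?iS //.
have -> : (i |: S) :\ j = i |: (S :\ j).
  apply/setP => k; rewrite !inE; case: (eqVneq k i) => [->|];
    rewrite ?(negPf ij) ?ij //.
rewrite (ltN ij); case: (lt j i) => /=;
  rewrite !(expr0, expr1, mulr1, mulrN, mulNr) //.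
  by rewrite [sg j S * (sg i _ * _)]mulrCA ?addNr ?subrr.
by rewrite [sg j S * (sg i _ * _)]mulrCA ?addNr ?subrr.
Qed.

Lemma bp_fp i j f : bp i (fp j f) = fp j (bp i f).
Proof. by apply: fockP => m S; rewrite /bp /fp /=; case: ifP; case: ifP;
  rewrite ?mulr0. Qed.
Lemma bp_fm i j f : bp i (fm j f) = fm j (bp i f).
Proof. by apply: fockP => m S; rewrite /bp /fm /=; case: ifP; case: ifP;
  rewrite ?mulr0. Qed.
Lemma bm_fp i j f : bm i (fp j f) = fp j (bm i f).
Proof. by apply: fockP => m S; rewrite /bm /fp /=; case: ifP;
  rewrite ?mulr0 // mulrCA. Qed.
Lemma bm_fm i j f : bm i (fm j f) = fm j (bm i f).
Proof. by apply: fockP => m S; rewrite /bm /fm /=; case: ifP;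
  rewrite ?mulr0 // mulrCA. Qed.

(** * Weight gradings and number operators *)

Section Weights.
Variables a c : O -> nat.
Definition weight (x : mon * {set O}) :=
  (\sum_i a i * x.1 i + \sum_(i in x.2) c i)%N.
Definition wpart (d : nat) f : fock := fun x => if weight x == d then f x else
  0.

Fact wpart_is_linear d : linear (wpart d).
Proof.
move=> b f g; apply/funext => x; rewrite /wpart !(fockD, fockZ).
by case: ifP; rewrite ?mulr0 ?addr0.
Qed.
HB.instance Definition _ d :=
  GRing.isLinear.Build K fock fock _ (wpart d) (wpart_is_linear d).

Lemma weight_up i m S : weight (up i m, S) = (weight (m, S) + a i)%N.
Proof.
rewrite /weight /= addnAC; congr (_ + _)%N.
rewrite (bigD1 i) //= [in RHS](bigD1 i) //= !ffunE eqxx mulnDr muln1.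
rewrite addnAC; congr (_ + _ + _)%N; apply: eq_bigr => j ji.
by rewrite ffunE (negPf ji) addn0.
Qed.
Lemma weight_dn i m S : (0 < m i)%N -> weight (m, S) = (weight (dn i m, S) + a
  i)%N.
Proof. by move=> mi; rewrite -weight_up dnK. Qed.
Lemma weight_D1 i m S : i \in S -> weight (m, S) = (weight (m, S :\ i) + c i)%N.
Proof. by move=> iS; rewrite /weight /= (big_setD1 i) //= [(c i + _)%N]addnC
  addnA. Qed.
Lemma weight_U1 i m S : i \notin S -> weight (m, i |: S) = (weight (m, S) + c
  i)%N.
Proof. by move=> iS; rewrite (weight_D1 m (setU11 i S)) setU1K. Qed.

Lemma wpartK d f : wpart d (wpart d f) = wpart d f.
Proof. by apply: fockP => m S; rewrite /wpart; case: (_ == d). Qed.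

Lemma wpart_bp d i f : wpart (d + a i) (bp i f) = bp i (wpart d f).
Proof.
apply: fockP => m S; rewrite /wpart /bp /=; case: (ltnP 0 (m i)) => mi;
  last by case: (_ == _).
by rewrite (weight_dn S mi) eqn_add2r.
Qed.
Lemma wpart_bp0 d i f : (d < a i)%N -> wpart d (bp i f) = 0.
Proof.
move=> da; apply: fockP => m S; rewrite /wpart /bp /=;
  case: (ltnP 0 (m i)) => mi; last by case: (_ == _).
by rewrite (weight_dn S mi) gtn_eqF // (leq_trans da) ?leq_addl.
Qed.
Lemma wpart_bm d i f : wpart d (bm i f) = bm i (wpart (d + a i) f).
Proof.
apply: fockP => m S; rewrite /wpart /bm /= weight_up eqn_add2r.
by case: ifP; rewrite ?mulr0.
Qed.
Lemma bm_wpart0 d i f : (d < a i)%N -> bm i (wpart d f) = 0.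
Proof.
move=> da; apply: fockP => m S; rewrite /wpart /bm /= weight_up.
by rewrite gtn_eqF ?mulr0 // (leq_trans da) ?leq_addl.
Qed.
Lemma wpart_fp d i f : wpart (d + c i) (fp i f) = fp i (wpart d f).
Proof.
apply: fockP => m S; rewrite /wpart /fp /=; case: (boolP (i \in S)) => iS;
  last by case: (_ == _).
by rewrite (weight_D1 m iS) eqn_add2r; case: ifP; rewrite ?mulr0.
Qed.
Lemma wpart_fp0 d i f : (d < c i)%N -> wpart d (fp i f) = 0.
Proof.
move=> dc; apply: fockP => m S; rewrite /wpart /fp /=;
  case: (boolP (i \in S)) => iS; last by case: (_ == _).
by rewrite (weight_D1 m iS) gtn_eqF // (leq_trans dc) ?leq_addl.
Qed.
Lemma wpart_fm d i f : wpart d (fm i f) = fm i (wpart (d + c i) f).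
Proof.
apply: fockP => m S; rewrite /wpart /fm /=; case: (boolP (i \in S)) => iS.
  by case: (_ == _).
by rewrite weight_U1 // eqn_add2r; case: ifP; rewrite ?mulr0.
Qed.
Lemma fm_wpart0 d i f : (d < c i)%N -> fm i (wpart d f) = 0.
Proof.
move=> dc; apply: fockP => m S; rewrite /wpart /fm /=;
  case: (boolP (i \in S)) => iS //.
by rewrite weight_U1 // gtn_eqF ?mulr0 // (leq_trans dc) ?leq_addl.
Qed.

(** Monomials are eigenvectors of multiplication after derivation, with the exponent as eigenvalue.
    This serves as Euler's identity and yields the factor by which polarization is undone. *)
Lemma wpart_number d f :
  \sum_i (a i)%:R *: bp i (bm i (wpart d f)) +
  \sum_i (c i)%:R *: fp i (fm i (wpart d f)) = d%:R *: wpart d f.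
Proof.
apply: fockP => m S; rewrite fockD !fock_sum fockZ /wpart.
have -> : \sum_i ((a i)%:R *: bp i (bm i (wpart d f))) (m, S) =
    (\sum_i a i * m i)%N%:R * wpart d f (m, S).
  rewrite natr_sum mulr_suml; apply: eq_bigr => i _.
  rewrite fockZ natrM -mulrA; congr (_ * _); rewrite /bp /bm /=.
  case: ifP => mi; last by move/negbT: mi; rewrite lt0n negbK => /eqP ->;
    rewrite mul0r.
  by rewrite dnK // ffunE eqxx subn1 prednK.
have -> : \sum_i ((c i)%:R *: fp i (fm i (wpart d f))) (m, S) =
    (\sum_(i in S) c i)%N%:R * wpart d f (m, S).
  rewrite natr_sum mulr_suml [RHS]big_mkcond; apply: eq_bigr => i _.
  rewrite fockZ /fp /fm /= !inE eqxx; case: ifP => iS; last by rewrite mulr0.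
  by rewrite setD1K // sgD1id [sg i S * _]mulrA sgK mul1r.
rewrite -mulrDl -natrD -/(weight (m, S)) /wpart.
by case: eqP => [->|]; rewrite ?mulr0.
Qed.
End Weights.
End Fock.

(** * Polarization *)

Lemma anticommutator_sums (K : fieldType) (W : lmodType K) (I J : finType)
    (F : I -> {linear W -> W}) (G : J -> {linear W -> W}) (R : I -> J -> W) w :
  (forall i j, F i (G j w) + G j (F i w) = R i j) ->
  \sum_i F i (\sum_j G j w) + \sum_j G j (\sum_i F i w) = \sum_i \sum_j R i j.
Proof.
move=> FG; under eq_bigr => i _ do rewrite linear_sum.
under [X in _ + X]eq_bigr => j _ do rewrite linear_sum.
rewrite [X in _ + X]exchange_big -big_split; apply: eq_bigr => i _ /=.
by rewrite -big_split; apply: eq_bigr => j _; apply: FG.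
Qed.

Lemma sum_delta (K : fieldType) (W : lmodType K) (I : finType) (i : I) (F : I
  -> W) :
  \sum_j (i == j)%:R *: F j = F i.
Proof.
rewrite (bigD1 i) //= eqxx scale1r big1 ?addr0 // => j ji.
by rewrite eq_sym (negPf ji) scale0r.
Qed.

Lemma sum_opp_rearrange (V : zmodType) (a1 a2 a3 a4 b1 b2 b3 b4 : V) :
  (a1 + b1) - (a2 + b2) + ((a3 + b3) - (a4 + b4)) = 0 ->
  a1 - a2 + (a3 - a4) = - (b1 + b3 - (b2 + b4)).
Proof.
move=> E; apply/eqP; rewrite -addr_eq0 -E !opprD.
rewrite [X in _ == X + _]addrACA [X in _ == _ + X]addrACA [X in _ == X]addrACA.
by rewrite [b1 + b3 + _]addrACA.
Qed.

Section Polarization.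
Variables (K : fieldType) (char0 : [pchar K] =i pred0) (n N : nat).
Notation X := ('I_n * 'I_N)%type.
Notation O := (X + 'I_n)%type.

(* inl (k, s) indexes N polynomial copies z_(k,s) of the coordinate x_k together
   with their Koszul variables eps_(k,s), which are odd; inr k indexes the odd
   coordinate x_k of the exterior algebra and its Koszul variable y_k, which is
   even. The differential kos sends eps to z and y to x. *)
Definition olt : rel O := fun i j =>
  match i, j with
  | inl p, inl q => (enum_rank p < enum_rank q)%N
  | inl _, inr _ => true
  | inr _, inl _ => false
  | inr k, inr l => (k < l)%N
  end.

Lemma oltxx i : olt i i = false.
Proof. by case: i => [p|k] /=; rewrite ltnn. Qed.

Lemma oltN i j : i != j -> olt i j = ~~ olt j i.
Proof.
case: i j => [p|k] [q|l] //= ij; rewrite -leqNgt [RHS]leq_eqVlt.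
  suff -> : (enum_rank p == enum_rank q :> nat) = false by [].
  apply: contraNF ij => /eqP/val_inj/enum_rank_inj ->; exact: eqxx.
suff -> : (k == l :> nat) = false by [].
by apply: contraNF ij => /eqP/val_inj ->.
Qed.

Notation W := (fock K O).
Notation bp := (@bp K O).
Notation bm := (@bm K O).
Notation fp := (@fp K O olt).
Notation fm := (@fm K O olt).
Notation z k s := (bp (inl (k, s))).
Notation dz k s := (bm (inl (k, s))).
Notation ep k s := (fp (inl (k, s))).
Notation ie k s := (fm (inl (k, s))).
Notation y k := (bp (inr k)).
Notation dy k := (bm (inr k)).
Notation x k := (fp (inr k)).
Notation dx k := (fm (inr k)).
Implicit Types (f g w : W) (s : 'I_N) (k : 'I_n).

Let fpN := @fpC K O olt oltN.
Let fmN := @fmC K O olt oltN.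
Let fm_fpD := @fm_fp K O olt oltxx oltN.

Lemma fm_fpN i j f : i != j -> fm i (fp j f) = - fp j (fm i f).
Proof.
by move=> ij; apply/eqP; rewrite -subr_eq0 opprK fm_fpD (negPf ij) scale0r.
Qed.

Definition kosA f : W := \sum_(p : X) bp (inl p) (fm (inl p) f).
Definition kosB f : W := \sum_k x k (dy k f).
Definition kos f : W := kosA f + kosB f.
(* nab s and nac s are the odd derivations exchanging slot s and the exterior
   slot: z -> x, eps -> -y for nab s and x -> z, y -> -eps for nac s. *)
Definition nabA s f : W := \sum_k x k (dz k s f).
Definition nabB s f : W := \sum_k y k (ie k s f).
Definition nab s f : W := nabA s f - nabB s f.
Definition nacA s f : W := \sum_k z k s (dx k f).
Definition nacB s f : W := \sum_k ep k s (dy k f).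
Definition nac s f : W := nacA s f - nacB s f.

Lemma comp_sum_is_linear (I : finType) (F : I -> {linear W -> W}) :
  linear (fun f => \sum_i F i f).
Proof.
move=> a f g; rewrite scaler_sumr -big_split; apply: eq_bigr => i _.
by rewrite linearP.
Qed.
Fact kosA_is_linear : linear kosA.
Proof. exact: (@comp_sum_is_linear _ (fun p : X => bp (inl p) \o fm (inl p))).
  Qed.
Fact kosB_is_linear : linear kosB.
Proof. exact: (@comp_sum_is_linear _ (fun k => x k \o dy k)). Qed.
Fact nabA_is_linear s : linear (nabA s).
Proof. exact: (@comp_sum_is_linear _ (fun k => x k \o dz k s)). Qed.
Fact nabB_is_linear s : linear (nabB s).
Proof. exact: (@comp_sum_is_linear _ (fun k => y k \o ie k s)). Qed.
Fact nacA_is_linear s : linear (nacA s).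
Proof. exact: (@comp_sum_is_linear _ (fun k => z k s \o dx k)). Qed.
Fact nacB_is_linear s : linear (nacB s).
Proof. exact: (@comp_sum_is_linear _ (fun k => ep k s \o dy k)). Qed.
HB.instance Definition _ := GRing.isLinear.Build K W W _ kosA kosA_is_linear.
HB.instance Definition _ := GRing.isLinear.Build K W W _ kosB kosB_is_linear.
HB.instance Definition _ s := GRing.isLinear.Build K W W _ (nabA s)
  (nabA_is_linear s).
HB.instance Definition _ s := GRing.isLinear.Build K W W _ (nabB s)
  (nabB_is_linear s).
HB.instance Definition _ s := GRing.isLinear.Build K W W _ (nacA s)
  (nacA_is_linear s).
HB.instance Definition _ s := GRing.isLinear.Build K W W _ (nacB s)
  (nacB_is_linear s).
Fact kos_is_linear : linear kos.
Proof. by move=> a f g; rewrite /kos !linearP scalerDr addrACA. Qed.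
Fact nab_is_linear s : linear (nab s).
Proof. by move=> a f g; rewrite /nab [nabA _ _]linearP [nabB _ _]linearP
  scalerBr opprD addrACA. Qed.
Fact nac_is_linear s : linear (nac s).
Proof. by move=> a f g; rewrite /nac [nacA _ _]linearP [nacB _ _]linearP
  scalerBr opprD addrACA. Qed.
HB.instance Definition _ := GRing.isLinear.Build K W W _ kos kos_is_linear.
HB.instance Definition _ s := GRing.isLinear.Build K W W _ (nab s)
  (nab_is_linear s).
HB.instance Definition _ s := GRing.isLinear.Build K W W _ (nac s)
  (nac_is_linear s).

(** Of the four anticommutators of the halves of [kos] and [nab s], those of [kosA] with [nabA] and
    of [kosB] with [nabB] both equal [R] and the others vanish; the minus sign in [nab] makes the
    two cancel. *)
Lemma kos_nab s f : kos (nab s f) = - nab s (kos f).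
Proof.
pose R := \sum_k x k (ie k s f).
have AP : kosA (nabA s f) + nabA s (kosA f) = R.
  rewrite (@anticommutator_sums _ _ _ _ (fun p : X => bp (inl p) \o fm (inl p))
    (fun k => x k \o dz k s) (fun p k => ((k, s) == p)%:R *: x k (fm (inl p)
      f))).
    by rewrite exchange_big; apply: eq_bigr => k _; rewrite sum_delta.
  move=> p k /=; rewrite fm_fpN // linearN /= bp_fp bm_bp linearD linearZ /=
    bm_fm.
  by rewrite addrA addNr add0r.
have AQ : kosA (nabB s f) + nabB s (kosA f) = 0.
  rewrite (@anticommutator_sums _ _ _ _ (fun p : X => bp (inl p) \o fm (inl p))
    (fun k => y k \o ie k s) (fun _ _ => 0)).
    by rewrite big1 // => p _; rewrite big1.
  move=> p k /=; rewrite -!bp_fm fmN !linearN /= bpC.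
  by rewrite addNr.
have BP : kosB (nabA s f) + nabA s (kosB f) = 0.
  rewrite (@anticommutator_sums _ _ _ _ (fun k => x k \o dy k)
    (fun k => x k \o dz k s) (fun _ _ => 0)).
    by rewrite big1 // => p _; rewrite big1.
  by move=> k l /=; rewrite !bm_fp fpN bmC addNr.
have BQ : kosB (nabB s f) + nabB s (kosB f) = R.
  rewrite (@anticommutator_sums _ _ _ _ (fun k => x k \o dy k)
    (fun k => y k \o ie k s) (fun k l => (k == l)%:R *: x k (ie l s f))).
    by apply: eq_bigr => k _; rewrite sum_delta.
  move=> k l /=; rewrite bm_bp linearD linearZ /= bm_fm fm_fpN // linearN /=
    bp_fp.
  by rewrite addrAC subrr add0r.
rewrite /kos /nab [kosA (_ - _)]linearB [kosB (_ - _)]linearB.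
rewrite [nabA s (_ + _)]linearD [nabB s (_ + _)]linearD /=.
by apply: sum_opp_rearrange; rewrite AP AQ BP BQ subr0 sub0r subrr.
Qed.

(** As for [nab], but here the mixed anticommutators survive and cancel. *)
Lemma kos_nac s f : kos (nac s f) = - nac s (kos f).
Proof.
pose R := \sum_k z k s (dy k f).
have AP : kosA (nacA s f) + nacA s (kosA f) = 0.
  rewrite (@anticommutator_sums _ _ _ _ (fun p : X => bp (inl p) \o fm (inl p))
    (fun k => z k s \o dx k) (fun _ _ => 0)).
    by rewrite big1 // => p _; rewrite big1.
  move=> p k /=; rewrite -!bp_fm fmN !linearN /= bpC.
  by rewrite addNr.
have AQ : kosA (nacB s f) + nacB s (kosA f) = R.
  rewrite (@anticommutator_sums _ _ _ _ (fun p : X => bp (inl p) \o fm (inl p))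
    (fun k => ep k s \o dy k) (fun p k => ((k, s) == p)%:R *: bp (inl p) (dy k
      f))).
    by rewrite exchange_big; apply: eq_bigr => k _; rewrite sum_delta.
  move=> p k /=; rewrite bm_bp scale0r addr0 -bp_fp -linearD /= bm_fm fm_fpD.
  by rewrite linearZ eq_sym.
have BP : kosB (nacA s f) + nacA s (kosB f) = R.
  rewrite (@anticommutator_sums _ _ _ _ (fun k => x k \o dy k)
    (fun k => z k s \o dx k) (fun l k => (l == k)%:R *: z k s (dy l f))).
    by apply: eq_bigr => k _; rewrite sum_delta.
  move=> l k /=; rewrite bm_bp scale0r addr0 -bp_fp -linearD /= bm_fm addrC
    fm_fpD.
  by rewrite linearZ eq_sym.
have BQ : kosB (nacB s f) + nacB s (kosB f) = 0.
  rewrite (@anticommutator_sums _ _ _ _ (fun k => x k \o dy k)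
    (fun k => ep k s \o dy k) (fun _ _ => 0)).
    by rewrite big1 // => p _; rewrite big1.
  by move=> k l /=; rewrite !bm_fp fpN bmC addNr.
rewrite /kos /nac [kosA (_ - _)]linearB [kosB (_ - _)]linearB.
rewrite [nacA s (_ + _)]linearD [nacB s (_ + _)]linearD /=.
by apply: sum_opp_rearrange; rewrite AP AQ BP BQ subr0 sub0r addNr.
Qed.

Lemma inl_slot_eq k l s : (inl (k, s) == inl (l, s) :> O) = (k == l).
Proof. by apply/eqP/eqP => [[->]|->]. Qed.

Definition free_slot s f := forall k, dz k s f = 0 /\ ie k s f = 0.

(** With these weights [xydeg] counts the variables x and y, that is, what remains to be moved,
    while [valdeg] counts z and x, the degree apart from the Koszul variables. The derivation [nac]
    lowers the first by one and preserves the second. *)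
Definition odd_wt (i : O) : nat := if i is inr _ then 1 else 0.
Definition even_wt (i : O) : nat := if i is inl _ then 1 else 0.
Notation xydeg d f := (wpart odd_wt odd_wt d f).
Notation valdeg d f := (wpart even_wt odd_wt d f).

(** On a free slot [nab] only meets the single variable that [nac] has just put there, so the
    composite is the number operator of the variables x and y. *)
Lemma nab_nac r s f : xydeg r f = f -> free_slot s f -> nab s (nac s f) = r%:R
  *: f.
Proof.
move=> hr fs.
have AA : nabA s (nacA s f) = \sum_k x k (dx k f).
  rewrite /nabA /nacA; apply: eq_bigr => k _; rewrite linear_sum.
  rewrite (eq_bigr (fun l => (k == l)%:R *: dx l f)) ?sum_delta // => l _ /=.
  by rewrite bm_bp bm_fm (fs k).1 !linear0 add0r inl_slot_eq.
have AB : nabA s (nacB s f) = 0.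
  rewrite /nabA /nacB big1 // => k _;
    rewrite linear_sum big1 ?linear0 // => l _ /=.
  by rewrite bm_fp bmC (fs k).1 !linear0.
have BA : nabB s (nacA s f) = 0.
  rewrite /nabB /nacA big1 // => k _;
    rewrite linear_sum big1 ?linear0 // => l _ /=.
  by rewrite -bp_fm fmN (fs k).2 linear0 oppr0 linear0.
have BB : nabB s (nacB s f) = \sum_k y k (dy k f).
  rewrite /nabB /nacB; apply: eq_bigr => k _; rewrite linear_sum.
  rewrite (eq_bigr (fun l => (k == l)%:R *: dy l f)) ?sum_delta // => l _ /=.
  have := fm_fpD (inl (k, s)) (inl (l, s)) (dy l f).
  rewrite -bm_fm (fs k).2 !linear0 addr0 => ->.
  by rewrite inl_slot_eq.
rewrite /nab /nac [nabA s (_ - _)]linearB [nabB s (_ - _)]linearB /=.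
rewrite AA AB BA BB subr0 sub0r opprK addrC -{3}hr -(wpart_number oltxx) hr.
rewrite !big_sumType /= [X in X + _ + _]big1 => [|p _]; last by rewrite scale0r.
rewrite [X in _ + (X + _)]big1 => [|p _]; last by rewrite scale0r.
by rewrite !add0r; congr (_ + _); apply: eq_bigr => k _; rewrite scale1r.
Qed.

Variables (T : finType) (S : T -> {vspace {ffun 'I_n -> K^o}}).
Implicit Types (U : {vspace {ffun 'I_n -> K^o}}) (v : {ffun 'I_n -> K^o}).

Definition zform s v f : W := \sum_k (v k : K) *: z k s f.
Definition xform v f : W := \sum_k (v k : K) *: x k f.

(** The forms of [U] are taken in every slot and in the exterior one, which makes the ideal stable
    under [nab] and [nac]: they merely relocate a form. *)
Inductive sid U : W -> Prop :=
| sid0 : sid U 0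
| sid_z w s v q : sid U w -> v \in U -> sid U (w + zform s v q)
| sid_x w v q : sid U w -> v \in U -> sid U (w + xform v q).

Definition scap w := forall i, sid (S i) w.

Lemma sid_add U f g : sid U f -> sid U g -> sid U (f + g).
Proof.
move=> Uf; elim=> [|w s v q _ IH vU|w v q _ IH vU]; first by rewrite addr0.
  by rewrite addrA; apply: sid_z.
by rewrite addrA; apply: sid_x.
Qed.

Lemma sid_zform U s v q : v \in U -> sid U (zform s v q).
Proof. by move=> vU; rewrite -[zform s v q]add0r; apply: sid_z => //;
  apply: sid0. Qed.

Lemma sid_xform U v q : v \in U -> sid U (xform v q).
Proof. by move=> vU; rewrite -[xform v q]add0r; apply: sid_x => //;
  apply: sid0. Qed.

Lemma sid_map U (h : {linear W -> W}) :
  (forall s v q, v \in U -> sid U (h (zform s v q))) ->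
  (forall v q, v \in U -> sid U (h (xform v q))) ->
  forall f, sid U f -> sid U (h f).
Proof.
move=> hz hx f; elim=> [|w s v q _ IH vU|w v q _ IH vU].
- by rewrite linear0; apply: sid0.
- by rewrite linearD; apply: sid_add IH (hz _ _ _ vU).
- by rewrite linearD; apply: sid_add IH (hx _ _ vU).
Qed.

Fact zform_is_linear s v : linear (zform s v).
Proof.
move=> a f g; rewrite /zform scaler_sumr -big_split /=; apply: eq_bigr => i _.
by rewrite linearP scalerDr !scalerA mulrC.
Qed.
Fact xform_is_linear v : linear (xform v).
Proof.
move=> a f g; rewrite /xform scaler_sumr -big_split /=; apply: eq_bigr => i _.
by rewrite linearP scalerDr !scalerA mulrC.
Qed.
HB.instance Definition _ s v :=
  GRing.isLinear.Build K W W _ (zform s v) (zform_is_linear s v).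
HB.instance Definition _ v :=
  GRing.isLinear.Build K W W _ (xform v) (xform_is_linear v).

Lemma sid_scale U a f : sid U f -> sid U (a *: f).
Proof.
apply: (sid_map (h := a \*: idfun)) => [s v q vU|v q vU] /=.
  by rewrite -[_ *: zform _ _ _]linearZ; apply: sid_zform.
by rewrite -[_ *: xform _ _]linearZ; apply: sid_xform.
Qed.

Lemma nab_x s k f : nab s (x k f) = - x k (nab s f).
Proof.
have A : nabA s (x k f) = - x k (nabA s f).
  rewrite /nabA linear_sum -sumrN; apply: eq_bigr => l _ /=.
  by rewrite bm_fp fpN.
have B : nabB s (x k f) = - x k (nabB s f).
  rewrite /nabB linear_sum -sumrN; apply: eq_bigr => l _ /=.
  by rewrite fm_fpN // linearN /= bp_fp.
by rewrite /nab A B linearB /= opprB opprK addrC.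
Qed.

Lemma nac_x s k f : nac s (x k f) = z k s f - x k (nac s f).
Proof.
have A : nacA s (x k f) = z k s f - x k (nacA s f).
  rewrite /nacA -(sum_delta k (fun l => z l s f)) linear_sum -sumrB.
  apply: eq_bigr => l _ /=; rewrite -bp_fp -linearZ -linearB /=; congr (bp _ _).
  rewrite (_ : (k == l) = (inr l == inr k :> O)); last by rewrite eq_sym.
  by rewrite -fm_fpD addrK.
have B : nacB s (x k f) = - x k (nacB s f).
  rewrite /nacB linear_sum -sumrN; apply: eq_bigr => l _ /=.
  by rewrite bm_fp fpN.
by rewrite /nac A B linearB /= opprB opprK -addrA [- _ + _]addrC.
Qed.

Lemma nab_xform s v f : nab s (xform v f) = - xform v (nab s f).
Proof.
rewrite /xform linear_sum -sumrN; apply: eq_bigr => k _.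
by rewrite linearZ /= nab_x scalerN.
Qed.

Lemma nac_xform s v f : nac s (xform v f) = zform s v f - xform v (nac s f).
Proof.
rewrite {1}/xform linear_sum /xform /zform -sumrB; apply: eq_bigr => k _.
by rewrite linearZ /= nac_x scalerBr.
Qed.

Lemma nab_z s s' k f :
  nab s (z k s' f) = z k s' (nab s f) + (s == s')%:R *: x k f.
Proof.
have A : nabA s (z k s' f) = z k s' (nabA s f) + (s == s')%:R *: x k f.
  rewrite /nabA linear_sum /=.
  have -> : (s == s')%:R *: x k f =
      \sum_l (inl (l, s) == inl (k, s') :> O)%:R *: x l f.
    have [<-|ss] := eqVneq s s'.
      rewrite scale1r; under eq_bigr => l _ do rewrite inl_slot_eq eq_sym.
      by rewrite (sum_delta k (fun l => x l f)).
    rewrite scale0r big1 // => l _; rewrite (_ : (_ == _) = false) ?scale0r //.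
    by apply: contraNF ss => /eqP[_ ->].
  rewrite -big_split; apply: eq_bigr => l _ /=.
  by rewrite bm_bp linearD linearZ /= bp_fp.
have B : nabB s (z k s' f) = z k s' (nabB s f).
  by rewrite /nabB linear_sum; apply: eq_bigr => l _ /=; rewrite -bp_fm bpC.
by rewrite /nab A B linearB /= addrAC.
Qed.

Lemma nab_zform s s' v f : nab s (zform s' v f) =
  zform s' v (nab s f) + (s == s')%:R *: xform v f.
Proof.
rewrite /xform scaler_sumr {1}/zform linear_sum /zform -big_split.
apply: eq_bigr => k _ /=.
by rewrite linearZ /= nab_z scalerDr !scalerA mulrC.
Qed.

Lemma nac_z s s' k f : nac s (z k s' f) = z k s' (nac s f).
Proof.
have A : nacA s (z k s' f) = z k s' (nacA s f).
  by rewrite /nacA linear_sum; apply: eq_bigr => l _ /=; rewrite -bp_fm bpC.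
have B : nacB s (z k s' f) = z k s' (nacB s f).
  rewrite /nacB linear_sum; apply: eq_bigr => l _ /=.
  by rewrite bm_bp scale0r addr0 bp_fp.
by rewrite /nac A B linearB.
Qed.

Lemma nac_zform s s' v f : nac s (zform s' v f) = zform s' v (nac s f).
Proof.
rewrite /zform linear_sum; apply: eq_bigr => k _.
by rewrite linearZ /= nac_z.
Qed.

Lemma scap_nab s f : scap f -> scap (nab s f).
Proof.
move=> fI i; apply: sid_map (fI i) => [s' v q vU|v q vU] /=.
  rewrite nab_zform; apply: sid_add; first exact: sid_zform.
  by apply/sid_scale/sid_xform.
by rewrite nab_xform -scaleN1r; apply/sid_scale/sid_xform.
Qed.

Lemma scap_nac s f : scap f -> scap (nac s f).
Proof.
move=> fI i; apply: sid_map (fI i) => [s' v q vU|v q vU] /=.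
  by rewrite nac_zform; apply: sid_zform.
rewrite nac_xform -scaleN1r; apply: sid_add; first exact: sid_zform.
by apply/sid_scale/sid_xform.
Qed.

Lemma scap_scale a f : scap f -> scap (a *: f).
Proof. by move=> fI i; apply: sid_scale. Qed.

Definition slot_embed s (v : {ffun 'I_n -> K^o}) : {ffun X -> K^o} :=
  [ffun p => if p.2 == s then v p.1 else 0].
Fact slot_embed_is_linear s : linear (slot_embed s).
Proof.
move=> a u v; apply/ffunP => p; rewrite !ffunE; case: ifP => //.
by rewrite scaler0 addr0.
Qed.
HB.instance Definition _ s := GRing.isLinear.Build K _ _ _ (slot_embed s)
  (slot_embed_is_linear s).

(** The copies of [U] in all slots are merged into one subspace, so the polynomial result is applied
    to the same number [#|T|] of ideals, whatever [N] is. *)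
Definition slots U : {vspace {ffun X -> K^o}} :=
  (\sum_s (linfun (slot_embed s) @: U))%VS.

Notation zlin := (lin (fun p : X => bp (inl p))).
Notation zlid := (lid (fun p : X => bp (inl p))).

Lemma lin_slot_embed s v f : zlin (slot_embed s v) f = zform s v f.
Proof.
rewrite /lin /zform (eq_bigr (fun p => (slot_embed s v (p.1, p.2) : K) *: z p.1
  p.2 f)).
  rewrite -(pair_bigA _ (fun k l => (slot_embed s v (k, l) : K) *: z k l f)) /=.
  apply: eq_bigr => k _; rewrite (bigD1 s) //= ffunE eqxx big1 ?addr0 // => l
    ls.
  by rewrite ffunE (negPf ls) scale0r.
by case.
Qed.

Lemma lid_slots_sid U f : zlid (slots U) f -> sid U f.
Proof.
elim=> [|w v q _ IH vU]; first exact: sid0.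
apply: sid_add => //; case/memv_sumP: vU => u uU ->.
rewrite lin_suml; elim/big_ind: _ => [||s _]; first exact: sid0.
  by move=> ? ?; apply: sid_add.
have /memv_imgP[v' v'U ->] := uU s isT.
by rewrite lfunE /= lin_slot_embed; apply: sid_zform.
Qed.

Lemma xydeg_bp d p f : xydeg d (bp (inl p) f) = bp (inl p) (xydeg d f).
Proof. by rewrite -wpart_bp addn0. Qed.
Lemma xydeg_fm d p f : xydeg d (fm (inl p) f) = fm (inl p) (xydeg d f).
Proof. by rewrite wpart_fm addn0. Qed.

Lemma sid_lid_slots U f : sid U f -> zlid (slots U) (xydeg 0 f).
Proof.
elim=> [|w s v q _ IH vU|w v q _ IH vU].
- by rewrite linear0; apply: lid0.
- rewrite linearD; apply: lid_add => //=.
  have -> : xydeg 0 (zform s v q) = zform s v (xydeg 0 q).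
    by rewrite linear_sum; apply: eq_bigr => k _; rewrite linearZ /= xydeg_bp.
  rewrite -lin_slot_embed; apply: lid_lin; rewrite /slots (bigD1 s) //=.
  apply: (subvP (addvSl _ _)); rewrite -[slot_embed s v]lfunE.
  exact: memv_img.
- rewrite linearD /= (_ : xydeg 0 (xform v q) = 0) ?addr0 //.
  by rewrite linear_sum big1 // => k _; rewrite linearZ /= wpart_fp0 ?scaler0.
Qed.

(** In the absence of x and y, [kos] is the Koszul differential of the polynomial variables and
    [valdeg] is the polynomial degree. *)
Lemma kos_acyclic_even j f : (#|T| <= j)%N -> xydeg 0 f = f -> valdeg j f = f ->
  scap (kos f) -> exists b, scap (f - kos b).
Proof.
move=> Tj f0 fj fI.
pose z' (p : X) : {linear W -> W} := bp (inl p).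
pose c' (p : X) : {linear W -> W} := fm (inl p).
have kosE g : xydeg 0 g = g -> kos g = koszul z' c' g.
  move=> g0; rewrite /kos /kosB big1 ?addr0 // => k _.
  by rewrite -g0 bm_wpart0 ?linear0.
have xykos g : xydeg 0 (koszul z' c' g) = koszul z' c' (xydeg 0 g).
  by rewrite linear_sum; apply: eq_bigr => p _; rewrite /= xydeg_bp xydeg_fm.
have zdeg_f : wpart even_wt (fun=> 0%N) j f = f.
  apply: fockP => m B; have [fz|fnz] := eqVneq (f (m, B)) 0.
    by rewrite /wpart fz; case: ifP.
  have /eqP w0 : weight odd_wt odd_wt (m, B) == 0%N.
    by apply: contraNT fnz => w; rewrite -f0 /wpart (negPf w).
  have /eqP vj : weight even_wt odd_wt (m, B) == j.
    by apply: contraNT fnz => w; rewrite -fj /wpart (negPf w).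
  rewrite /wpart ifT //; apply/eqP; move: w0 vj; rewrite /weight /= => /eqP.
  rewrite addn_eq0 => /andP[_ /eqP ->]; rewrite addn0 => <-.
  by rewrite [X in (_ + X)%N]big1 ?addn0.
pose D' (p : X) : {linear W -> W} := bm (inl p).
pose e' (p : X) : {linear W -> W} := fp (inl p).
pose ph d : {linear W -> W} := wpart even_wt (fun=> 0%N) d.
have zC p q w : z' p (z' q w) = z' q (z' p w) by apply: bpC.
have Dz p q w : D' p (z' q w) = z' q (D' p w) + (p == q)%:R *: w by apply:
  bm_bp.
have ez p q w : e' p (z' q w) = z' q (e' p w) by symmetry; apply: bp_fp.
have cz p q w : c' p (z' q w) = z' q (c' p w) by symmetry; apply: bp_fm.
have ce p q w : c' p (e' q w) + e' q (c' p w) = (p == q)%:R *: w by apply: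
  fm_fpD.
have cC p q w : c' p (c' q w) = - c' q (c' p w) by apply: fmN.
have ph0z p w : ph 0%N (z' p w) = 0 by apply: wpart_bp0.
have phSz d p w : ph d.+1 (z' p w) = z' p (ph d w).
  by rewrite /ph -[d.+1]addn1 /=; exact: (wpart_bp even_wt _ d (inl p)).
have Dph0 p w : D' p (ph 0%N w) = 0 by apply: bm_wpart0.
have DphS d p w : D' p (ph d.+1 w) = ph d (D' p w).
  by symmetry; rewrite /ph -[d.+1]addn1 /=;
    exact: (wpart_bm even_wt _ d (inl p)).
have phc d p w : ph d (c' p w) = c' p (ph d w).
  by rewrite /ph /= wpart_fm addn0.
have phK d w : ph d (ph d w) = ph d w by apply: wpartK.
have euler d w : \sum_p z' p (D' p (ph d w)) = d%:R *: ph d w.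
  rewrite -(wpart_number oltxx) [X in _ = _ + X]big1 => [|i _];
    last by rewrite scale0r.
  rewrite addr0 big_sumType /= [X in _ = _ + X]big1 => [|i _];
    last by rewrite scale0r.
  by rewrite addr0; apply: eq_bigr => p _; rewrite scale1r.
have mf : lmix z' (fun i => slots (S i)) [set: T] 0%VS (koszul z' c' f).
  apply: lmix_capl => i _; rewrite -f0 -xykos -kosE //.
  exact: sid_lid_slots.
rewrite -cardsT in Tj.
have [b [p [q [pI q0 fE]]]] := koszul_acyclic char0 zC Dz ez cz ce cC ph0z phSz
  Dph0 DphS phc phK euler Tj zdeg_f mf.
(* Truncation returns [b] to the elements free of x and y, on which the two differentials agree. *)
exists (xydeg 0 b); rewrite kosE ?wpartK // -xykos -{1}f0 -linearB fE => i.
have -> : q = 0.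
  elim: q0 => // w v r _ -> /[!memv0] /eqP ->;
    rewrite add0r /lin big1 // => p' _.
  by rewrite ffunE scale0r.
rewrite addr0; apply: lid_slots_sid; have := pI i (in_setT i).
apply: (lid_map (f := wpart odd_wt odd_wt 0)) => v r vS.
have E : xydeg 0 (lin z' v r) = lin z' v (xydeg 0 r).
  by rewrite linear_sum; apply: eq_bigr => p' _; rewrite linearZ /= xydeg_bp.
by rewrite -[_ (lin _ _ _)]/(xydeg 0 (lin z' v r)) E; apply: lid_lin.
Qed.

Lemma nac_xydeg r s f : xydeg r.+1 f = f -> xydeg r (nac s f) = nac s f.
Proof.
move=> fr.
have A : xydeg r (nacA s f) = nacA s f.
  rewrite linear_sum; apply: eq_bigr => k _.
  by rewrite /= xydeg_bp wpart_fm addn1 fr.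
have B : xydeg r (nacB s f) = nacB s f.
  rewrite linear_sum; apply: eq_bigr => k _ /=.
  have -> : xydeg r (ep k s (dy k f)) = ep k s (xydeg r (dy k f)).
    by rewrite -wpart_fp addn0.
  by rewrite wpart_bm addn1 fr.
by rewrite /nac linearB /= A B.
Qed.

Lemma nac_valdeg j s f : valdeg j f = f -> valdeg j (nac s f) = nac s f.
Proof.
move=> fj.
have A : valdeg j (nacA s f) = nacA s f.
  rewrite linear_sum; apply: eq_bigr => k _ /=.
  case: j fj => [|j] fj; first by rewrite -fj fm_wpart0 // !linear0.
  by rewrite -[j.+1]addn1 (wpart_bp even_wt _ j (inl (k, s))) wpart_fm addn1 fj.
have B : valdeg j (nacB s f) = nacB s f.
  rewrite linear_sum; apply: eq_bigr => k _ /=.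
  have -> : valdeg j (ep k s (dy k f)) = ep k s (valdeg j (dy k f)).
    by rewrite -wpart_fp addn0.
  by rewrite wpart_bm addn0 fj.
by rewrite /nac linearB /= A B.
Qed.

Lemma nac_free_slot s s' f : s != s' -> free_slot s' f -> free_slot s' (nac s
  f).
Proof.
move=> ss fs l; have [f1 f2] := fs l.
have ne k : (inl (l, s') == inl (k, s) :> O) = false.
  by apply: contraNF ss => /eqP[_ ->].
split; rewrite /nac linearB /=.
  rewrite /nacA /nacB [X in X - _]linear_sum big1 => [|k _] /=.
    rewrite sub0r [X in - X]linear_sum big1 ?oppr0 // => k _ /=.
    by rewrite bm_fp bmC f1 !linear0.
  by rewrite bm_bp ne scale0r addr0 bm_fm f1 !linear0.
rewrite /nacA /nacB [X in X - _]linear_sum big1 => [|k _] /=.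
  rewrite sub0r [X in - X]linear_sum big1 ?oppr0 // => k _ /=.
  by rewrite fm_fpN ?ne // -bm_fm f2 !linear0.
by rewrite -bp_fm fmN f2 linear0 oppr0 linear0.
Qed.

(* nac s moves one degree from the exterior slot to the unused slot s; as
   nab s (nac s f) = r f, acyclicity descends, and for r = 0 it is the
   statement koszul_acyclic on polynomials. *)
Lemma kos_acyclic r j f : (r <= N)%N -> (#|T| <= j)%N ->
  xydeg r f = f -> valdeg j f = f ->
  (forall s : 'I_N, (N - r <= s)%N -> free_slot s f) ->
  scap (kos f) -> exists b, scap (f - kos b).
Proof.
move=> rN Tj; elim: r => [|r IHr] in f rN *; first by move=> f0 fj _;
  apply: kos_acyclic_even Tj f0 fj.
move=> fr fj fs fI.
have sN : (N - r.+1 < N)%N by rewrite ltn_subrL /= (leq_trans _ rN).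
(* The first of the slots known to be free; those after it remain free for the induction. *)
pose s := Ordinal sN.
have [|||s' ss||b bI] := IHr (nac s f).
- exact: ltnW.
- exact: nac_xydeg.
- exact: nac_valdeg.
- apply: nac_free_slot; last by apply: fs; apply: leq_trans ss;
    rewrite leq_sub2l.
  by rewrite -val_eqE /= ltn_eqF // (leq_trans _ ss) // ltn_sub2l.
- rewrite kos_nac -scaleN1r; apply/scap_scale/scap_nac/fI.
(* The sign makes up for the anticommutation of [kos] with [nab s]. *)
exists (- (r.+1%:R^-1 *: nab s b)).
have := scap_scale r.+1%:R^-1 (scap_nab s bI).
rewrite [nab s (_ - _)]linearB /= (nab_nac fr); last exact: fs.
rewrite scalerBr scalerA mulVf ?natr_eq0 // scale1r.
by rewrite [kos (- _)]linearN /= [kos (_ *: _)]linearZ /= kos_nab scalerN opprK.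
Qed.

End Polarization.

(** * Cochains over the exterior algebra *)

Section Cochains.
Variables (K : fieldType) (n : nat).
Notation E := (exterior K n).
Notation mindex := {ffun 'I_n -> nat}.
Implicit Types (u : E) (k l : 'I_n) (al be : mindex) (B : {set 'I_n}).

Lemma ext_genM k u B : (ext_gen K k * u) B =
  if k \in B then (-1) ^+ #|[set l in B | (l < k)%N]| * u (B :\ k) else 0.
Proof.
rewrite ext_mulE; case: (boolP (k \in B)) => kB; last first.
  rewrite big1 // => S SB; rewrite ffunE (_ : (S == _) = false) ?mulr0 ?mul0r
    //.
  by apply: contraNF kB => /eqP S1; rewrite -sub1set -S1.
rewrite (bigD1 [set k]) ?sub1set //= big1 ?addr0 => [|S /andP[_ Sk]];
  last first.
  by rewrite ffunE (negPf Sk) mulr0 mul0r.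
rewrite ffunE eqxx mulr1; congr (_ * _); rewrite /ext_sign /ext_inv big_set1.
congr (_ ^+ _); rewrite -sum1_card big_mkcond [RHS]big_mkcond;
  apply: eq_bigr => l _.
rewrite !inE; case: (ltngtP l k) => [lk|lk|/val_inj ->];
  rewrite ?andbF ?andbT ?ltnn //.
  by case: eqP lk => [->|_]; rewrite ?ltnn //=; case: (l \in B).
all: by case: ifP.
Qed.

Definition mdeg al : nat := (\sum_k al k)%N.
Definition mfact al : nat := (\prod_k (al k)`!)%N.

Lemma mdeg_up k al : mdeg (up k al) = (mdeg al).+1.
Proof.
rewrite /mdeg (bigD1 k) //= [in RHS](bigD1 k) //= ffunE eqxx addn1 addSn.
by congr (_ + _).+1; apply: eq_bigr => l lk; rewrite ffunE (negPf lk) addn0.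
Qed.

Lemma mfact_up k al : mfact (up k al) = ((al k).+1 * mfact al)%N.
Proof.
rewrite /mfact (bigD1 k) //= [in RHS](bigD1 k) //= ffunE eqxx addn1 factS mulnA.
by congr (_ * _)%N; apply: eq_bigr => l lk; rewrite ffunE (negPf lk) addn0.
Qed.

(* The complex D (x) M computing Tor(M, K), with D the divided powers of the
   space of linear forms: c al is the coefficient of the divided monomial al. *)
Definition cdiff (M : lmodType E) (c : mindex -> M) al : M :=
  \sum_k ext_gen K k *: c (up k al).

(** The generators anticommute and square to zero, while the index shifts commute. *)
Lemma cdiffK (M : lmodType E) (c : mindex -> M) al : cdiff (cdiff c) al = 0.
Proof.
rewrite /cdiff; under eq_bigr => k _ do rewrite scaler_sumr.
rewrite pair_bigA /=.
have half (F : 'I_n -> 'I_n -> M) : (forall k, F k k = 0) ->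
    (forall k l, F k l = - F l k) -> \sum_p F p.1 p.2 = 0.
  move=> F0 FN; rewrite -(pair_bigA _ F) /=.
  rewrite (eq_bigr (fun k => \sum_(l : 'I_n | (l < k)%N) F k l + \sum_(l : 'I_n
    | (k < l)%N) F k l)).
    rewrite big_split /= [X in _ + X](exchange_big_dep xpredT) //= -big_split
      big1 // => k _ /=.
    by rewrite -big_split big1 // => l _ /=; rewrite FN addNr.
  move=> k _; rewrite (bigD1 k) //= F0 add0r (bigID (fun l : 'I_n => (l <
    k)%N)) /=.
  congr (_ + _); apply: eq_bigl => l.
    by rewrite ltn_neqAle -val_eqE /= andbA andbb.
  by rewrite -leqNgt ltn_neqAle -val_eqE eq_sym.
rewrite (half (fun k l => ext_gen K k *: (ext_gen K l *: c (up l (up k al)))))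
  //.
  by move=> k; rewrite scalerA ext_gen_sqr scale0r.
by move=> k l; rewrite !scalerA ext_gen_anticomm scaleNr upC.
Qed.

Definition lform (v : {ffun 'I_n -> K^o}) : E := \sum_k (v k : K) *: ext_gen K
  k.

(** Right multiples suffice for a two-sided ideal, since a linear form passes any element at the
    cost of signs ([ext_Mlform]). *)
Inductive eid (U : {vspace {ffun 'I_n -> K^o}}) : E -> Prop :=
| eid0 : eid U 0
| eidD u v q : eid U u -> v \in U -> eid U (u + lform v * q).

Lemma lform_sum (I : Type) (r : seq I) (F : I -> {ffun 'I_n -> K^o}) :
  lform (\sum_(i <- r) F i) = \sum_(i <- r) lform (F i).
Proof.
elim/big_rec2: _ => [|i y x _ <-].
  by rewrite /lform big1 // => k _; rewrite ffunE scale0r.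
by rewrite /lform -big_split; apply: eq_bigr => k _; rewrite ffunE scalerDl.
Qed.

Lemma lformZ a v : lform (a *: v) = a *: lform v.
Proof.
rewrite /lform scaler_sumr; apply: eq_bigr => k _.
by rewrite ffunE scalerA.
Qed.

Lemma eid_add U u v : eid U u -> eid U v -> eid U (u + v).
Proof.
move=> Uu; elim=> [|w x q _ IH xU]; first by rewrite addr0.
by rewrite addrA; apply: eidD.
Qed.

Lemma eid_lform (U : {vspace {ffun 'I_n -> K^o}}) v q : v \in U -> eid U (lform
  v * q).
Proof. by move=> vU; rewrite -[lform v * q]add0r; apply: eidD => //;
  apply: eid0. Qed.

(** The number of coefficients does not depend on [u], so that in [extend_sid] the coefficients for
    different multi-indices can be assembled into single elements. *)
Lemma eid_basis U u : eid U u ->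
  exists q : 'I_(\dim U) -> E, u = \sum_(i < \dim U) lform (vbasis U)`_i * q i.
Proof.
elim=> [|w v p _ [q ->] vU].
  by exists (fun=> 0); rewrite big1 // => i _; rewrite mulr0.
exists (fun i => q i + coord (vbasis U) i v *: p).
rewrite [in LHS](coord_vbasis vU) lform_sum mulr_suml -big_split.
apply: eq_bigr => i _ /=; rewrite lformZ mulrDr -scalerAl -scalerAr //.
Qed.

End Cochains.

(** * Passage between cochains over E and polarized elements *)

Section Bridge.
Variables (K : fieldType) (char0 : [pchar K] =i pred0) (n N : nat).
Notation E := (exterior K n).
Notation mindex := {ffun 'I_n -> nat}.
Notation X := ('I_n * 'I_N)%type.
Notation O := (X + 'I_n)%type.
Notation W := (fock K O).
Implicit Types (m : {ffun O -> nat}) (B : {set O}) (al be : mindex) (f : W).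

Definition mon_inr m : mindex := [ffun k => m (inr k)].
Definition set_inr B : {set 'I_n} := [set k | inr k \in B].
Definition mon_ext al : {ffun O -> nat} := [ffun i => if i is inr k then al k
  else 0%N].
Definition set_ext (A : {set 'I_n}) : {set O} := [set i | if i is inr k then k
  \in A else false].
Definition pure m B := [forall p : X, (m (inl p) == 0%N) && (inl p \notin B)].

(* The factorials convert between the monomials of fock and divided powers. *)
Definition restr f al : E :=
  [ffun A : {set 'I_n} => (mfact al)%:R * f (mon_ext al, set_ext A)].
Definition extend (a : nat) (c : mindex -> E) : W := fun x =>
  if pure x.1 x.2 && (mdeg (mon_inr x.1) == a)
  then (mfact (mon_inr x.1))%:R^-1 * c (mon_inr x.1) (set_inr x.2) else 0.

Notation bp := (@bp K O).
Notation bm := (@bm K O).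
Notation fp := (@fp K O (@olt n N)).
Notation fm := (@fm K O (@olt n N)).

Lemma mon_extK al : mon_inr (mon_ext al) = al.
Proof. by apply/ffunP => k; rewrite !ffunE. Qed.
Lemma set_extK A : set_inr (set_ext A) = A.
Proof. by apply/setP => k; rewrite !inE. Qed.
Lemma pure_ext al A : pure (mon_ext al) (set_ext A).
Proof. by apply/forallP => p; rewrite !ffunE !inE. Qed.

Lemma mfact_neq0 al : (mfact al)%:R != 0 :> K.
Proof. by rewrite natr_eq0 // -lt0n prodn_gt0 // => k; rewrite fact_gt0. Qed.

Lemma extendK a c al : mdeg al = a -> restr (extend a c) al = c al.
Proof.
move=> da; apply/ffunP => A; rewrite ffunE /extend /= pure_ext mon_extK da eqxx
  /=.
by rewrite set_extK mulrA divff ?mul1r ?mfact_neq0.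
Qed.

Lemma restr_x k f al : restr (fp (inr k) f) al = ext_gen K k * restr f al.
Proof.
apply/ffunP => A; rewrite ext_genM !ffunE /fp /= !inE.
case: ifP => kA; last by rewrite mulr0.
rewrite mulrCA; congr (_ * (_ * f (_, _))).
  rewrite /sg; congr (_ ^+ _).
  rewrite -[RHS](card_imset _ (@inr_inj X 'I_n)); apply: eq_card => i.
  rewrite !inE; apply/andP/imsetP => [|[l]];
    last by rewrite !inE => /andP[lA lk] ->.
  by case: i => [p|l] []// lA /= lk; exists l; rewrite // !inE lA.
by apply/setP => -[p|l]; rewrite !inE.
Qed.

Lemma restr_dy k f al : restr (bm (inr k) f) al = restr f (up k al).
Proof.
apply/ffunP => A; rewrite !ffunE /bm /= ffunE mfact_up natrM mulrA [_ *
  _%:R]mulrC.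
congr (_ * f (_, _)); apply/ffunP => -[p|l]; rewrite !ffunE //.
Qed.

Lemma restr_z p f al : restr (bp (inl p) f) al = 0.
Proof. by apply/ffunP => A; rewrite !ffunE /bp /= ffunE mulr0. Qed.

Lemma restrD f g al : restr (f + g) al = restr f al + restr g al.
Proof. by apply/ffunP => A; rewrite !ffunE fockD mulrDr. Qed.
Lemma restrZ a f al : restr (a *: f) al = a *: restr f al.
Proof. by apply/ffunP => A; rewrite !ffunE fockZ mulrCA. Qed.
Lemma restr0 al : restr 0 al = 0.
Proof. by apply/ffunP => A; rewrite !ffunE fock0 mulr0. Qed.
Lemma restrB f g al : restr (f - g) al = restr f al - restr g al.
Proof. by rewrite -scaleN1r restrD restrZ scaleN1r. Qed.
Lemma restr_sum (I : Type) (r : seq I) (F : I -> W) al :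
  restr (\sum_(i <- r) F i) al = \sum_(i <- r) restr (F i) al.
Proof. by elim/big_rec2: _ => [|i y g _ <-]; rewrite ?restr0 ?restrD. Qed.

(** Restriction kills multiples of slot variables, hence the whole of [kosA]; what is left of [kos]
    is the differential of the Tor complex. *)
Lemma restr_kos f al : restr (kos f) al = cdiff (M := E^o) (restr f) al.
Proof.
rewrite restrD !restr_sum big1 ?add0r => [|p _]; last exact: restr_z.
by apply: eq_bigr => k _; rewrite restr_x restr_dy.
Qed.

Lemma restr_sid U f al : sid U f -> eid U (restr f al).
Proof.
elim=> [|w s v q _ IH vU|w v q _ IH vU]; rewrite ?restr0 ?restrD;
  first exact: eid0.
  rewrite [X in _ + X](_ : _ = 0) ?addr0 // restr_sum big1 // => k _.
  by rewrite restrZ restr_z scaler0.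
apply: eid_add => //; rewrite (_ : restr _ al = lform v * restr q al).
  exact: eid_lform.
rewrite restr_sum mulr_suml; apply: eq_bigr => k _.
by rewrite restrZ restr_x -scalerAl.
Qed.

Lemma extend_x k a c : fp (inr k) (extend a c) = extend a (fun be => ext_gen K
  k * c be).
Proof.
apply: fockP => m B; rewrite /fp /extend /=.
have pureD : pure m (B :\ inr k) = pure m B.
  by apply: eq_forallb => p; rewrite !inE.
rewrite pureD; case: (boolP (pure m B)) => [/forallP pB|_] /=;
  last by case: ifP => _; rewrite ?mulr0.
case: (mdeg _ == a); last by case: ifP => _; rewrite ?mulr0.
rewrite ext_genM inE; case: ifP => kB; last by rewrite mulr0.
rewrite mulrCA; congr (_ * (_ * c _ _)).
  rewrite /sg; congr (_ ^+ _).
  rewrite -[RHS](card_imset _ (@inr_inj X 'I_n)); apply: eq_card => i.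
  rewrite !inE; apply/andP/imsetP => [|[l]];
    last by rewrite !inE => /andP[lA lk] ->.
  case: i => [p [pp]|l [lA lk]]; first by have := pB p; rewrite pp andbF.
  by exists l; rewrite // !inE lA.
by apply/setP => l; rewrite !inE.
Qed.

Lemma extend_dy k a c : bm (inr k) (extend a.+1 c) = extend a (fun be => c (up
  k be)).
Proof.
apply: fockP => m B; rewrite /bm /extend /=.
have -> : pure (up (inr k) m) B = pure m B.
  by apply: eq_forallb => p; rewrite !ffunE addn0.
have -> : mon_inr (up (inr k) m) = up k (mon_inr m).
  by apply/ffunP => l; rewrite !ffunE.
rewrite mdeg_up eqSS; case: ifP => _; last by rewrite mulr0.
rewrite mfact_up ffunE natrM invfM !mulrA divff ?mul1r //.
by rewrite natr_eq0.
Qed.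

Lemma extend_dy0 k c : bm (inr k) (extend 0 c) = 0.
Proof.
apply: fockP => m B; rewrite /bm /extend /=.
have -> : mon_inr (up (inr k) m) = up k (mon_inr m).
  by apply/ffunP => l; rewrite !ffunE.
by rewrite mdeg_up andbF mulr0.
Qed.

Lemma extend_inl a c p : bm (inl p) (extend a c) = 0 /\ fm (inl p) (extend a c)
  = 0.
Proof.
split; apply: fockP => m B; rewrite /bm /fm /extend /=.
  rewrite (_ : pure _ _ = false) ?mulr0 //; apply/negP => /forallP/(_ p).
  by rewrite ffunE eqxx addn1.
case: ifP => // _; rewrite (_ : pure _ _ = false) ?mulr0 //.
by apply/negP => /forallP/(_ p); rewrite setU11 andbF.
Qed.

Lemma extend_sid U a c : (forall al, mdeg al = a -> eid U (c al)) -> sid U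
  (extend a c).
Proof.
move=> cU.
have /choice[q qP] al : exists q : 'I_(\dim U) -> E,
    mdeg al = a -> c al = \sum_(i < \dim U) lform (vbasis U)`_i * q i.
  have [/cU/eid_basis[q qE]|ne] := eqVneq (mdeg al) a; first by exists q.
  by exists (fun=> 0) => /eqP; rewrite (negPf ne).
have -> : extend a c = \sum_(i < \dim U) xform (vbasis U)`_i (extend a (fun al
  => q al i)).
  have xE (i : 'I_(\dim U)) : xform (vbasis U)`_i (extend a (fun al => q al i))
    =
      extend a (fun al => lform (vbasis U)`_i * q al i).
    rewrite /xform; apply: fockP => m B; rewrite fock_sum.
    rewrite (eq_bigr (fun k => ((vbasis U)`_i k : K) *
      extend a (fun be => ext_gen K k * q be i) (m, B))); last first.
      by move=> k _; rewrite fockZ extend_x.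
    rewrite /extend /=; case: ifP => _; last by rewrite big1 // => k _;
      rewrite mulr0.
    rewrite /lform mulr_suml sum_ffunE mulr_sumr; apply: eq_bigr => k _.
    by rewrite -scalerAl ext_scaleE mulrCA.
  under eq_bigr => i _ do rewrite xE.
  apply: fockP => m B; rewrite fock_sum /extend /=;
    case: ifP => [/andP[_ /eqP da]|_].
    by rewrite -mulr_sumr -sum_ffunE -qP.
  by rewrite big1.
elim/big_ind: _ => [|? ?|i _]; [exact: sid0|exact: sid_add|apply: sid_xform].
by rewrite vbasis_mem // mem_nth // size_tuple.
Qed.

Variables (T : finType) (S : T -> {vspace {ffun 'I_n -> K^o}}).
Definition ecap (u : E) := forall i, eid (S i) u.

(** Monomials of [f] contain [a] variables y and [j] variables x, each to be moved to a slot of its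
    own; hence [N = a + j]. In homological terms, $D \otimes E/I$ is exact where the values have
    degree at least [#|T|]. *)
Lemma cochain_acyclic a j (c : mindex -> E^o) : (a + j)%N = N -> (#|T| <= j)%N
  ->
  (forall al, mdeg al = a -> ext_homog j (c al)) ->
  (forall be, (mdeg be).+1 = a -> ecap (cdiff c be)) ->
  exists b : mindex -> E^o, forall al, mdeg al = a -> ecap (c al - cdiff b al).
Proof.
move=> aj Tj hc dc; pose f := extend a c.
have wt0 m B (P : Prop) : (f (m, B) != 0 ->
  [/\ forall p, m (inl p) = 0%N, forall p, inl p \notin B,
     mdeg (mon_inr m) = a & #|set_inr B| = j] -> P) -> f (m, B) != 0 -> P.
  move=> h fnz; apply: h => //; move: fnz; rewrite /f /extend /=.
  case: ifP => [/andP[/forallP pB /eqP da]|]; last by rewrite eqxx.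
  rewrite mulf_eq0 negb_or => /andP[_ cnz]; split=> // [p|p|].
  - by have /andP[/eqP] := pB p.
  - by have /andP[] := pB p.
  - exact: hc cnz.
have sumB B : (forall p, inl p \notin B) ->
    (\sum_(i in B) odd_wt i)%N = #|set_inr B|.
  move=> pB; rewrite (eq_bigr (fun=> 1%N)) => [|[p|k]] //;
    last by rewrite (negPf (pB p)).
  rewrite sum1_card -(card_imset _ (@inr_inj X 'I_n)); apply: eq_card => i.
  apply/idP/imsetP => [iB|[k]]; last by rewrite inE => kB ->.
  by case: i iB => [p|k] iB; [rewrite (negPf (pB p)) in iB|exists k;
    rewrite ?inE].
have [||||s _ k|i|b bI] := kos_acyclic (S := S) char0 (r := N) (j := j) (f :=
  f).
- by [].
- by [].
- apply: fockP => m B; rewrite /wpart; case: eqVneq => // ne.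
  apply/esym/eqP; apply/negPn/negP; apply: wt0 => _ [m0 B0 da db];
    case/negP: ne.
  rewrite /weight /= sumB // db big_sumType /= big1 ?add0n => [|p _];
    last by [].
  rewrite (_ : (\sum_(k < n) _)%N = a) ?aj // -da; apply: eq_bigr => k _.
  by rewrite mul1n ffunE.
- apply: fockP => m B; rewrite /wpart; case: eqVneq => // ne.
  apply/esym/eqP; apply/negPn/negP; apply: wt0 => _ [m0 B0 da db];
    case/negP: ne.
  rewrite /weight /= sumB // db big_sumType /= big1 ?add0n => [|p _].
    by rewrite big1.
  by rewrite m0 muln0.
- by apply: extend_inl.
- rewrite /kos /kosA big1 ?add0r => [|p _]; last first.
    by rewrite (extend_inl _ _ _).2 linear0.
  rewrite /kosB; case: a => [|a] in aj hc dc f wt0 *.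
    by rewrite big1 => [|k _]; rewrite ?extend_dy0 ?linear0 //; apply: sid0.
  have -> : \sum_k fp (inr k) (bm (inr k) f) = extend a (cdiff c).
    rewrite (eq_bigr (fun k => extend a (fun be => ext_gen K k * c (up k be)))).
      apply: fockP => m B; rewrite fock_sum /extend /=; case: ifP => _;
        last by rewrite big1.
      by rewrite -mulr_sumr -sum_ffunE.
    by move=> k _; rewrite extend_dy extend_x.
  by apply: extend_sid => be db; apply: dc; rewrite db.
exists (restr b) => al da i.
rewrite -(extendK c da) -restr_kos -restrB.
exact: restr_sid.
Qed.
End Bridge.

(** * Ideals of linear forms and homogeneous components in E *)

Section Graded.
Variables (K : fieldType) (n : nat).
Notation E := (exterior K n).
Notation mindex := {ffun 'I_n -> nat}.
Implicit Types (u : E) (k l : 'I_n) (al be : mindex) (B : {set 'I_n}).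

Definition grade_inv u : E := [ffun B : {set 'I_n} => (-1) ^+ #|B| * u B].

Lemma ext_Mgen k u : u * ext_gen K k = ext_gen K k * grade_inv u.
Proof.
apply/ffunP => B; rewrite ext_genM ext_mulE ffunE.
case: ifP => kB; last first.
  rewrite big1 // => S SB; rewrite [X in _ * X]ffunE (_ : (_ == _) = false)
    ?mulr0 //.
  by apply: contraFF kB => /eqP/setP/(_ k); rewrite !inE eqxx => /andP[].
rewrite (bigD1 (B :\ k)) ?subsetDl //= big1 ?addr0 => [|S /andP[SB Sk]];
  last first.
  rewrite [X in _ * X]ffunE (_ : (_ == _) = false) ?mulr0 //.
  apply: contraNF Sk => /eqP BS; apply/eqP/setP => l; move/setP/(_ l): BS.
  rewrite !inE; case: (eqVneq l k) => [->|_] /=.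
    by case: (k \in S).
  by case: (boolP (l \in S)) => [/(subsetP SB) ->|_] /= => [_|->].
have -> : B :\: (B :\ k) = [set k].
  by apply/setP => l; rewrite !inE; case: eqP => [->|] //=; case: (l \in B).
rewrite ffunE eqxx mulr1 mulrA -exprD; congr (_ * _).
rewrite /ext_sign /ext_inv; under eq_bigr => l _ do rewrite big_set1.
rewrite -signr_odd -[in RHS]signr_odd; congr (_ ^+ _).
have -> : #|[set l in B | (l < k)%N]| = (\sum_(l in B :\ k) (l < k))%N.
  rewrite -sum1_card big_mkcond [RHS]big_mkcond; apply: eq_bigr => l _.
  rewrite !inE; case: (eqVneq l k) => [->|_] /=; first by rewrite ltnn andbF.
  by case: (l \in B) => //=; case: ifP.
have -> : #|B :\ k| = (\sum_(l in B :\ k) (l < k) + \sum_(l in B :\ k) (k <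
  l))%N.
  rewrite -sum1_card -big_split; apply: eq_bigr => l;
    rewrite !inE => /andP[lk _] /=.
  by move: lk; rewrite -val_eqE /=; case: (ltngtP l k).
by rewrite addnA addnn oddD odd_double.
Qed.

Lemma ext_Mlform (v : {ffun 'I_n -> K^o}) u : u * lform v = lform v * grade_inv
  u.
Proof.
rewrite /lform mulr_sumr mulr_suml; apply: eq_bigr => k _.
by rewrite -scalerAr -scalerAl ext_Mgen.
Qed.

Lemma eid_ideal U : is_ideal (eid (K := K) (n := n) U).
Proof.
split; [exact: eid0|exact: eid_add|move=> a u b].
elim=> [|w v q _ IH vU]; first by rewrite mulr0 mul0r; apply: eid0.
rewrite mulrDr mulrDl; apply: eid_add => //.
by rewrite !mulrA ext_Mlform -!mulrA; apply: eid_lform.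
Qed.

Lemma eid_gen (G : E -> Prop) (U : {vspace {ffun 'I_n -> K^o}}) u :
  (forall g, G g <-> exists2 v, v \in U & g = lform v) ->
  ideal_gen G u <-> eid U u.
Proof.
move=> GU; split=> [uG|uU I [I0 ID IM] GI].
  apply: uG; first exact: eid_ideal.
  by move=> g /GU[v vU ->]; rewrite -[lform v]mulr1; apply: eid_lform.
elim: uU => [//|w v q _ IH vU]; apply: ID => //.
by rewrite -[lform v]mul1r; apply/IM/GI/GU; exists v.
Qed.

Definition ann_fun (W : {vspace 'rV[K]_n}) (v : {ffun 'I_n -> K^o}) :
    {ffun 'I_(\dim W) -> K^o} :=
  [ffun b : 'I_(\dim W) => \sum_k v k * (vbasis W)`_b 0 k].
Fact ann_fun_is_linear W : linear (ann_fun W).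
Proof.
move=> a u v; apply/ffunP => b; rewrite !ffunE scaler_sumr -big_split.
by apply: eq_bigr => k _; rewrite !ffunE mulrDl /= /GRing.scale /= mulrA.
Qed.
HB.instance Definition _ W := GRing.isLinear.Build K _ _ _ (ann_fun W)
  (ann_fun_is_linear W).
Definition annihilator W : {vspace {ffun 'I_n -> K^o}} := lker (linfun (ann_fun
  W)).

Lemma annihilatorP (W : {vspace 'rV[K]_n}) (v : {ffun 'I_n -> K^o}) : reflect
  (forall x, x \in W -> \sum_k v k * x 0 k = 0)
  (v \in annihilator W).
Proof.
rewrite memv_ker lfunE /=; apply: (iffP eqP) => [/ffunP h x xW|h].
  rewrite (coord_vbasis xW); under eq_bigr => k _ do rewrite summxE mulr_sumr.
  rewrite exchange_big big1 // => b _ /=; have := h b; rewrite !ffunE => hb.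
  under eq_bigr => k _ do rewrite mxE mulrCA.
  by rewrite -mulr_sumr hb mulr0.
apply/ffunP => b; rewrite !ffunE; apply: h.
by rewrite vbasis_mem // mem_nth // size_tuple.
Qed.

Lemma vanishing_formsP (W : {vspace 'rV[K]_n}) g :
  vanishing_forms W g <-> exists2 v, v \in annihilator W & g = lform v.
Proof.
split=> [[l lW ->]|[v /annihilatorP vW ->]].
  exists [ffun k => l (delta_mx 0 k)]; last first.
    by apply: eq_bigr => k _; rewrite ffunE.
  apply/annihilatorP => x xW; have := lW x xW;
    rewrite {1}(row_sum_delta x) linear_sum /=.
  move=> h; rewrite -[RHS]h; apply: eq_bigr => k _; rewrite ffunE linearZ /=.
  by rewrite /GRing.scale /= mulrC.
have lin : linear (fun x : 'rV[K]_n => \sum_k v k * x 0 k : K^o).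
  move=> a x y; rewrite scaler_sumr -big_split; apply: eq_bigr => k _.
  by rewrite !mxE mulrDr /GRing.scale /= mulrCA.
pose lL := GRing.isLinear.Build _ _ _ _ _ lin.
pose ll : {linear 'rV[K]_n -> K^o} := HB.pack (fun x : 'rV[K]_n => \sum_k v k *
  x 0 k : K^o) lL.
exists (linfun ll) => [x xW|]; first by rewrite lfunE /= vW.
rewrite /linear_form /lform; apply: eq_bigr => k _; congr (_ *: _);
  rewrite lfunE /= (bigD1 k) //= mxE !eqxx mulr1.
by rewrite big1 ?addr0 // => l lk; rewrite mxE (negPf lk) andbF mulr0.
Qed.

(** The component of total degree [j] when [u] is the coefficient of a generator of degree [d]. *)
Definition hcomp (d j : nat) u : E :=
  [ffun B : {set 'I_n} => if (#|B| + d == j)%N then u B else 0].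

Fact hcomp_is_linear d j : linear (hcomp d j).
Proof.
move=> a u v; apply/ffunP => B; rewrite ext_addE ext_scaleE /hcomp !ffunE.
by case: ifP => _ //; rewrite mulr0 addr0.
Qed.
HB.instance Definition _ d j := GRing.isLinear.Build K _ _ _ (hcomp d j)
  (hcomp_is_linear d j).

Lemma hcompS d j k u : hcomp d j.+1 (ext_gen K k * u) = ext_gen K k * hcomp d j
  u.
Proof.
apply/ffunP => B; rewrite ext_genM ffunE ext_genM;
  case: (boolP (k \in B)) => kB; last by case: ifP.
rewrite ffunE (cardsD1 k B) kB addSn eqSS.
by case: ifP; rewrite ?mulr0.
Qed.

Lemma hcomp0 d k u : hcomp d 0 (ext_gen K k * u) = 0.
Proof.
apply/ffunP => B; rewrite ffunE ext_genM [RHS]ffunE;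
  case: (boolP (k \in B)) => kB; last by case: ifP.
by rewrite (cardsD1 k B) kB.
Qed.

Lemma eid_hcomp U d j u : eid U u -> eid U (hcomp d j u).
Proof.
elim=> [|w v q _ IH vU]; first by rewrite linear0; apply: eid0.
rewrite linearD; apply: eid_add => //=.
have lE : lform v * q = \sum_k (v k : K) *: (ext_gen K k * q).
  by rewrite mulr_suml; apply: eq_bigr => k _; rewrite -scalerAl.
case: j => [|j] in IH *.
  rewrite lE linear_sum big1 => [|k _]; first exact: eid0.
  by rewrite linearZ /= hcomp0 scaler0.
rewrite (_ : hcomp _ _ _ = lform v * hcomp d j q); first exact: eid_lform.
rewrite lE mulr_suml linear_sum; apply: eq_bigr => k _.
by rewrite -scalerAl linearZ /= hcompS.
Qed.

Lemma hcomp_id d j u : (forall B, u B != 0 -> (#|B| + d)%N = j) <-> hcomp d j u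
  = u.
Proof.
split=> [h|uE B]; last first.
  rewrite -uE ffunE; case: ifP => [/eqP->|_] //. by move=> /eqP.
apply/ffunP => B; rewrite ffunE; case: ifP => // /eqP nj.
by apply/esym/eqP/negPn/negP => /h.
Qed.

Lemma ext_homogP d u : ext_homog d u <-> hcomp 0 d u = u.
Proof.
rewrite -hcomp_id; split=> h B /h; first by move->; rewrite addn0.
by rewrite addn0.
Qed.

Lemma hcompK d j u : hcomp d j (hcomp d j u) = hcomp d j u.
Proof.
apply/hcomp_id => B; rewrite ffunE; case: ifP => [/eqP->|_] //.
by move=> /eqP.
Qed.

Lemma hcomp_cdiff d j (c : mindex -> E^o) al :
  hcomp d j.+1 (cdiff c al) = cdiff (fun be => hcomp d j (c be) : E^o) al.
Proof. by rewrite linear_sum; apply: eq_bigr => k _ /=; apply: hcompS. Qed.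

Lemma sum_hcomp u : \sum_(j < n.+1) hcomp 0 j u = u.
Proof.
apply/ffunP => B; rewrite sum_ffunE.
have Bn : (#|B| < n.+1)%N by rewrite ltnS -[X in (_ <= X)%N]card_ord max_card.
rewrite (bigD1 (Ordinal Bn)) //= ffunE addn0 eqxx big1 ?addr0 // => j jB.
by rewrite ffunE addn0 eq_sym (negPf (contraNneq _ jB)) // => E;
  apply/eqP/val_inj.
Qed.

End Graded.

(** * Acyclicity over E and dimension shifting *)

Section Acyclic.
Variables (K : fieldType) (char0 : [pchar K] =i pred0) (n : nat).
Notation E := (exterior K n).
Notation mindex := {ffun 'I_n -> nat}.
Implicit Types (u : E) (k l : 'I_n) (al be : mindex).

Lemma eq_cdiff (M : lmodType E) (c c' : mindex -> M) al :
  (forall k, c (up k al) = c' (up k al)) -> cdiff c al = cdiff c' al.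
Proof. by move=> cc; apply: eq_bigr => k _; rewrite cc. Qed.

Lemma cdiffB (M : lmodType E) (c c' : mindex -> M) al :
  cdiff (fun be => c be - c' be) al = cdiff c al - cdiff c' al.
Proof. by rewrite -sumrB; apply: eq_bigr => k _; rewrite scalerBr. Qed.

(** The zero ideal is an intersection of one linear ideal, so [cochain_acyclic] with [#|T| = 1]
    covers every positive degree [j.+1]. *)
Lemma cochain_exact a j (c : mindex -> E^o) :
  (forall al, mdeg al = a -> ext_homog j.+1 (c al)) ->
  (forall be, (mdeg be).+1 = a -> cdiff c be = 0) ->
  exists b : mindex -> E^o, (forall be, ext_homog j (b be)) /\
    forall al, mdeg al = a -> c al = cdiff b al.
Proof.
move=> hc dc.
have [||be db i|b bP] := @cochain_acyclic K char0 n _ unit (fun=> 0%VS) a j.+1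
  c erefl.
- by rewrite card_unit.
- exact: hc.
- by rewrite dc //; apply: eid0.
exists (fun be => hcomp 0 j (b be)); split=> [be|al da];
  first exact/ext_homogP/hcompK.
have cE : c al = cdiff b al.
  apply/eqP; rewrite -subr_eq0; apply/eqP; have := bP al da tt.
  elim=> // u v q _ -> /[!memv0] /eqP ->;
    rewrite add0r /lform big1 ?mul0r // => k _.
  by rewrite ffunE scale0r.
rewrite -hcomp_cdiff -cE; apply/esym/ext_homogP/hc/da.
Qed.

Section Ideal.
Variables (T : finType) (S : T -> {vspace {ffun 'I_n -> K^o}}).

(** The connecting map of $0 \to I \to E \to E/I \to 0$. Over $E$ the cocycle [c] bounds some [b],
    which is a cocycle modulo $I$, hence a boundary modulo $I$; subtracting that boundary moves [b]
    into $I$ without changing its differential. As [b] has degree one less than [c], a bound of at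
    least t for $E/I$ becomes one above t for $I$. *)
Lemma ecap_acyclic a j (c : mindex -> E^o) : (#|T| <= j)%N ->
  (forall al, mdeg al = a -> ecap S (c al) /\ ext_homog j.+1 (c al)) ->
  (forall be, (mdeg be).+1 = a -> cdiff c be = 0) ->
  exists b : mindex -> E^o,
    (forall be, mdeg be = a.+1 -> ecap S (b be) /\ ext_homog j (b be)) /\
    forall al, mdeg al = a -> c al = cdiff b al.
Proof.
move=> Tj hc dc; have [|b [hb cE]] := cochain_exact (j := j) _ dc;
  first by move=> al /hc[].
have [||be [db] i|e eP] := @cochain_acyclic K char0 n _ T S a.+1 j b erefl.
- by [].
- by move=> al _; apply: hb.
- by rewrite -cE //; apply: (hc be db).1.
exists (fun be => hcomp 0 j (b be - cdiff e be)); split=> [be db|al da].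
  split; last exact/ext_homogP/hcompK.
  by move=> i; apply/eid_hcomp/eP.
have := hcomp_cdiff 0 j (fun be => b be - cdiff e be) al => /= <-.
rewrite cdiffB cdiffK subr0 -cE //; apply/esym/ext_homogP.
exact: (hc al da).2.
Qed.
End Ideal.

Section Free.
Variables (r : nat) (d : 'I_r -> nat).
Implicit Types (v w : 'rV[E]_r).

Definition hrow j v : 'rV[E]_r := \row_k hcomp (d k) j (v 0 k).

Lemma free_homogP j v : free_homog d j v <-> hrow j v = v.
Proof.
split=> [h|hv k B].
  by apply/rowP => k; rewrite mxE; apply/hcomp_id => B /h.
by move: hv => /rowP/(_ k); rewrite mxE => /hcomp_id h /h.
Qed.

Lemma hrow_homog j v : free_homog d j (hrow j v).
Proof. by apply/free_homogP/rowP => k; rewrite !mxE hcompK. Qed.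

Lemma hrowS j k v : hrow j.+1 (ext_gen K k *: v) = ext_gen K k *: hrow j v.
Proof. by apply/rowP => l; rewrite !mxE hcompS. Qed.

Lemma hrowB j v w : hrow j (v - w) = hrow j v - hrow j w.
Proof. by apply/rowP => l; rewrite !mxE linearB. Qed.

Lemma hrow_sum j (I : Type) (s : seq I) (F : I -> 'rV[E]_r) :
  hrow j (\sum_(i <- s) F i) = \sum_(i <- s) hrow j (F i).
Proof.
elim/big_rec2: _ => [|i x y _ <-]; apply/rowP => l; rewrite !mxE ?linear0 //.
by rewrite linearD.
Qed.

Lemma hrow_cdiff j (c : mindex -> 'rV[E]_r) al :
  hrow j.+1 (cdiff c al) = cdiff (fun be => hrow j (c be)) al.
Proof. by rewrite hrow_sum; apply: eq_bigr => k _; rewrite hrowS. Qed.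

Lemma cdiff_entry (c : mindex -> 'rV[E]_r) al (k : 'I_r) :
  cdiff c al 0 k = cdiff (fun be => c be 0 k : E^o) al.
Proof. by rewrite /cdiff summxE; apply: eq_bigr => l _; rewrite mxE. Qed.

(** At the index obtained by lowering [al] at [k], the cocycle equation has the constant term of
    [c al] as its coefficient of $x_k$. *)
Lemma cocycle_set0 a (c : mindex -> E^o) al :
  (forall be, (mdeg be).+1 = a.+1 -> cdiff c be = 0) -> mdeg al = a.+1 ->
  (c al : E) set0 = 0.
Proof.
move=> dc da; have [k ak] : exists k, (0 < al k)%N.
  apply/existsP; apply: contra_eqT da; rewrite negb_exists => /forallP a0.
  by rewrite /mdeg big1 // => k _; have := a0 k; rewrite lt0n negbK => /eqP.
have := dc (dn k al); rewrite -(mdeg_up k) dnK // => /(_ da).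
move/(congr1 (fun u : E => u [set k]));
  rewrite /cdiff sum_ffunE (bigD1 k) //= dnK //.
rewrite big1 ?addr0 => [|l lk]; last first.
  by rewrite [LHS]ext_genM inE (negPf lk).
rewrite [LHS]ext_genM set11 ext_zeroE (_ : [set k] :\ k = set0); last first.
  by apply/setP => l; rewrite !inE; case: eqP.
by rewrite (_ : [set _ in _ | _] = set0) ?cards0 ?mul1r //;
  apply/setP => l; rewrite !inE; case: eqP => [->|//]; rewrite ltnn.
Qed.

(** Apply [cochain_exact] to each entry. The vanishing of constant terms excludes the homology $K$
    of $D \otimes E$ in index degree 0. *)
Lemma free_exact a j (c : mindex -> 'rV[E]_r) :
  (forall al, mdeg al = a -> free_homog d j.+1 (c al)) ->
  (forall be, (mdeg be).+1 = a -> cdiff c be = 0) ->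
  (forall al (k : 'I__), mdeg al = a -> c al 0 k set0 = 0) ->
  exists b : mindex -> 'rV[E]_r, (forall be, free_homog d j (b be)) /\
    forall al, mdeg al = a -> c al = cdiff b al.
Proof.
move=> hc dc c0.
have /fin_all_exists[b bP] (k : 'I_r) : exists b : mindex -> E^o,
    (forall be B, (b be : E) B != 0 -> (#|B| + d k)%N = j) /\
    forall al, mdeg al = a -> c al 0 k = cdiff b al.
  have [dj|jd] := leqP (d k) j; last first.
    (* With [d k > j], total degree [j.+1] leaves room for a constant at most, so the entry is
       zero. *)
    exists (fun=> 0); split=> [be B|al da]; first by rewrite ext_zeroE eqxx.
    have -> : cdiff (fun=> 0 : E^o) al = 0 by rewrite /cdiff big1 // => l _;
      rewrite scaler0.
    apply/ffunP => B; rewrite ext_zeroE; apply/eqP/negPn/negP => cB.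
    have : (#|B| <= 0)%N by rewrite -(leq_add2r (d k)) (hc al da k B cB) add0n.
    by rewrite leqn0 cards_eq0 => /eqP B0; move: cB; rewrite B0 c0 // => /eqP.
  have [al da B|be db|b [hb cE]] := cochain_exact (a := a) (j := j - d k)
      (c := fun al => c al 0 k).
  - by move/(hc al da k B) => E1; rewrite -subSn // -E1 addnK.
  - by rewrite -cdiff_entry dc // mxE.
  exists b; split=> // be B /hb ->; exact: subnK.
exists (fun be => \row_k (b k be : E)); split=> [be k B|al da].
  by rewrite mxE; apply: (bP k).1.
apply/rowP => k; rewrite (bP k).2 // cdiff_entry; apply: eq_bigr => l _.
by rewrite mxE.
Qed.
End Free.

(** For graded [M] this is the vanishing of $Tor_a(M,K)$ in degree $a + j + 1$: the cocycle has
    values of degree [j.+1], the bounding cochain of degree [j]. *)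
Definition acyclic r (d : 'I_r -> nat) (M : 'rV[E]_r -> Prop) (a j : nat) :=
  forall c : mindex -> 'rV[E]_r,
  (forall al, mdeg al = a -> M (c al) /\ free_homog d j.+1 (c al)) ->
  (forall be, (mdeg be).+1 = a -> cdiff c be = 0) ->
  exists b : mindex -> 'rV[E]_r,
    (forall be, mdeg be = a.+1 -> M (b be) /\ free_homog d j (b be)) /\
    forall al, mdeg al = a -> c al = cdiff b al.

Section Syzygy.
Variables (r r' : nat) (d : 'I_r -> nat) (d' : 'I_r' -> nat) (D : 'M[E]_(r',
  r)).
Hypothesis hD : forall k : 'I_r', free_homog d (d' k) (row k D).

Lemma hrow_mul j (w : 'rV[E]_r') : hrow d j (w *m D) = hrow d' j w *m D.
Proof.
apply/rowP => k; rewrite !mxE linear_sum; apply: eq_bigr => l _ /=; rewrite mxE.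
apply/ffunP => B; rewrite ffunE !ext_mulE; case: ifP => [/eqP Bj|Bj].
  apply: eq_bigr => A AB; rewrite ffunE; case: ifP => // /negbT Aj.
  suff -> : D l k (B :\: A) = 0 by rewrite !mulr0.
  apply/eqP; apply: contraNT Aj => DB.
  have := @hD l => /(_ k (B :\: A)); rewrite mxE => /(_ DB) <-.
  by rewrite addnA -Bj -(cardsID A B) (setIidPr AB).
rewrite big1 // => A AB; rewrite ffunE; case: ifP => Aj;
  last by rewrite mulr0 mul0r.
suff -> : D l k (B :\: A) = 0 by rewrite !mulr0.
apply/eqP; apply: contraFT Bj => DB.
have := @hD l => /(_ k (B :\: A)); rewrite mxE => /(_ DB) dl.
by rewrite -(eqP Aj) -dl addnA -(cardsID A B) (setIidPr AB).
Qed.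

Lemma cdiff_mul (c : mindex -> 'rV[E]_r') al :
  cdiff c al *m D = cdiff (fun be => c be *m D) al.
Proof.
by rewrite /cdiff mulmx_suml; apply: eq_bigr => k _; rewrite scalemxAl.
Qed.

Variable M : 'rV[E]_r -> Prop.
Hypothesis MD : forall v, M v <-> exists w, v = w *m D.

(** Dimension shifting along $0 \to Z \to F' \to M \to 0$ with $Z$ the kernel of [D]. The cocycle
    bounds some [b] in $F'$; the image of [b] in $M$ is a cocycle of the next index degree, so it
    bounds there, and lifting the bounding cochain to $F'$ gives the correction that moves [b] into
    $Z$. *)
Lemma syzygy_boundary a j (c : mindex -> 'rV[E]_r') : acyclic d M a.+1 j ->
  (forall al, mdeg al = a -> c al *m D = 0 /\ free_homog d' j.+2 (c al)) ->
  (forall be, (mdeg be).+1 = a -> cdiff c be = 0) ->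
  (forall al (k : 'I__), mdeg al = a -> c al 0 k set0 = 0) ->
  exists b : mindex -> 'rV[E]_r',
    (forall be, mdeg be = a.+1 -> b be *m D = 0 /\ free_homog d' j.+1 (b be)) /\
    forall al, mdeg al = a -> c al = cdiff b al.
Proof.
move=> aM hc dc c0.
have [|b [hb cE]] := free_exact (d := d') (j := j.+1) _ dc c0;
  first by move=> al /hc[_].
have [be _|al [da]|g [hg bE]] := aM (fun be => b be *m D).
- split; first by apply/MD; exists (b be).
  by apply/(free_homogP d); rewrite hrow_mul (free_homogP _ _ _).1.
- by rewrite -cdiff_mul -cE // (hc al da).1.
have /choice[h hP] ga : exists h : 'rV[E]_r',
    mdeg ga = a.+2 -> g ga = h *m D /\ free_homog d' j h.
  have [dg|dg] := eqVneq (mdeg ga) a.+2; last by exists 0 => /eqP;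
    rewrite (negPf dg).
  have [/MD[w gE] hgg] := hg ga dg; exists (hrow d' j w) => _; split.
    by rewrite -hrow_mul -gE (free_homogP _ _ _).1.
  exact: hrow_homog.
exists (fun be => b be - cdiff h be); split=> [be db|al da]; last first.
  by rewrite cdiffB cdiffK subr0 cE.
split.
  rewrite mulmxBl bE // cdiff_mul; apply/eqP; rewrite subr_eq0; apply/eqP.
  by apply: eq_cdiff => k; apply: (hP _ _).1; rewrite mdeg_up db.
apply/free_homogP; rewrite hrowB hrow_cdiff; congr (_ - _);
  first exact/free_homogP.
by apply: eq_cdiff => k; apply/free_homogP/(hP _ _).2; rewrite mdeg_up db.
Qed.

Lemma syzygy_acyclic a j : acyclic d M a.+2 j ->
  acyclic d' (fun w => w *m D = 0) a.+1 j.+1.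
Proof.
move=> aM c hc dc; apply: syzygy_boundary => // al k da.
apply: (@cocycle_set0 a (fun be => c be 0 k : E^o)) => // be db.
by rewrite -cdiff_entry dc // mxE.
Qed.
End Syzygy.
End Acyclic.

(** * Vanishing of Tor *)

Section Tor.
Variables (K : fieldType) (n : nat).
Notation E := (exterior K n).
Notation mindex := {ffun 'I_n -> nat}.

Definition mx0 r r' (A : 'M[E]_(r, r')) : 'M[K]_(r, r') :=
  map_mx (fun u : E => u set0) A.

Lemma ext_mul_set0 (u v : E) : (u * v) set0 = u set0 * v set0.
Proof.
rewrite ext_mulE (bigD1 set0) //= big1 => [|S /andP[]].
  by rewrite setD0 ext_sign0l mul1r addr0.
by rewrite subset0 => ->.
Qed.

Lemma mx0_mul r r' r'' (A : 'M[E]_(r, r')) (B : 'M[E]_(r', r'')) :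
  mx0 (A *m B) = mx0 A *m mx0 B.
Proof.
apply/matrixP => i j; rewrite !mxE sum_ffunE; apply: eq_bigr => k _.
by rewrite ext_mul_set0 !mxE.
Qed.

Definition mxE_of r (v : 'rV[K]_r) : 'rV[E]_r := map_mx (fun a => a%:A) v.

Lemma mxE_ofK r (v : 'rV[K]_r) : mx0 (mxE_of v) = v.
Proof.
by apply/rowP => k; rewrite !mxE ext_scaleE [X in _ * X]ffunE eqxx mulr1.
Qed.

Lemma mxE_of_homog r (d : 'I_r -> nat) j (v : 'rV[K]_r) :
  (forall k, v 0 k != 0 -> d k = j) -> free_homog d j (mxE_of v).
Proof.
move=> hv k B; rewrite mxE ext_scaleE [X in _ * X]ffunE mulf_eq0 negb_or.
by move=> /andP[/hv <-]; case: (eqVneq B set0) => [->|_ /eqP]; rewrite ?cards0.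
Qed.

(** Subtracting $\sum_k x_k w_k$ moves the lift of [v] into the kernel of [D], the image of [D'],
    and does not change its constant terms. *)
Lemma tensor_boundary r r' r'' (D : 'M[E]_(r', r)) (D' : 'M[E]_(r'', r'))
    (v : 'rV[K]_r') (b : mindex -> 'rV[E]_r) :
  (forall w : 'rV[E]_r', w *m D = 0 <-> exists w', w = w' *m D') ->
  (forall k, exists w : 'rV[E]_r', b (up k [ffun=> 0%N]) = w *m D) ->
  mxE_of v *m D = cdiff b [ffun=> 0%N] -> exists w, v = w *m mx0 D'.
Proof.
move=> kerD /fin_all_exists[w wP] vE.
pose q := \sum_k ext_gen K k *: w k.
have /kerD[w' w'E] : (mxE_of v - q) *m D = 0.
  rewrite mulmxBl vE mulmx_suml; apply/eqP; rewrite subr_eq0; apply/eqP.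
  by apply: eq_bigr => k _; rewrite wP -scalemxAl.
exists (mx0 w'); rewrite -mx0_mul -w'E -[LHS]mxE_ofK.
apply/rowP => k; rewrite !mxE ext_addE ext_oppE summxE sum_ffunE big1 ?subr0 //.
by move=> l _; rewrite mxE ext_genM inE.
Qed.

Lemma mdeg0 : mdeg ([ffun=> 0%N] : mindex) = 0%N.
Proof. by rewrite /mdeg big1 // => k _; rewrite ffunE. Qed.

Hypothesis char0 : [pchar K] =i pred0.

(** The image under [D'] of the lift of [v] lies in the kernel of [D], and has no constant terms
    because [v] is a cycle. Dimension shifting in index degree 0 writes it as $\sum_k x_k b_k$ with
    all $b_k$ in that kernel, as [tensor_boundary] requires. *)
Lemma tor_step r r' r'' r3 (d : 'I_r -> nat) (d' : 'I_r' -> nat) (d'' : 'I_r''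
  -> nat)
    (D : 'M[E]_(r', r)) (D' : 'M[E]_(r'', r')) (D'' : 'M[E]_(r3, r'')) M j (v :
      'rV[K]_r'') :
  (forall k, free_homog d (d' k) (row k D)) ->
  (forall k, free_homog d' (d'' k) (row k D')) ->
  (forall u, M u <-> exists w : 'rV[E]_r', u = w *m D) ->
  (forall u : 'rV[E]_r', u *m D = 0 <-> exists w, u = w *m D') ->
  (forall u : 'rV[E]_r'', u *m D' = 0 <-> exists w, u = w *m D'') ->
  acyclic d M 1 j ->
  (forall k, v 0 k != 0 -> d'' k = j.+2) -> v *m mx0 D' = 0 ->
  exists w, v = w *m mx0 D''.
Proof.
move=> hD hD' MD kerD kerD' aM hv vD.
pose u := mxE_of v *m D'.
have [al _|be|al k _|b [bP uE]] := @syzygy_boundary K char0 n _ _ d d' D hD M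
  MD 0 j (fun=> u) aM.
- split; first by apply/kerD; exists (mxE_of v).
  apply/free_homogP; rewrite (hrow_mul hD'); congr (_ *m _).
  exact/free_homogP/mxE_of_homog.
- by [].
- have : mx0 u 0 k = 0 by rewrite mx0_mul mxE_ofK vD mxE.
  by rewrite mxE.
apply: (tensor_boundary (D := D') (b := b)) => // [k|];
  last by rewrite -uE // mdeg0.
by apply/kerD; apply: (bP _ _).1; rewrite mdeg_up mdeg0.
Qed.

Lemma tor_step0 r r' r'' (d : 'I_r -> nat) (d' : 'I_r' -> nat)
    (D : 'M[E]_(r', r)) (D' : 'M[E]_(r'', r')) M j (v : 'rV[K]_r') :
  (forall k, free_homog d (d' k) (row k D)) ->
  (forall u, M u <-> exists w : 'rV[E]_r', u = w *m D) ->
  (forall u : 'rV[E]_r', u *m D = 0 <-> exists w, u = w *m D') ->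
  acyclic d M 0 j -> (forall k, v 0 k != 0 -> d' k = j.+1) ->
  exists w, v = w *m mx0 D'.
Proof.
move=> hD MD kerD aM hv; pose u := mxE_of v *m D.
have [al _|//|b [bP uE]] := aM (fun=> u).
  split; first by apply/MD; exists (mxE_of v).
  apply/free_homogP; rewrite (hrow_mul hD); congr (_ *m _).
  exact/free_homogP/mxE_of_homog.
apply: (tensor_boundary (D := D) (b := b)) => // [k|];
  last by rewrite -uE // mdeg0.
by apply/MD; apply: (bP _ _).1; rewrite mdeg_up mdeg0.
Qed.

(** * Regularity and generators of the intersection ideal *)

Variables (t : nat) (W : 'I_t -> {vspace 'rV[K]_n}).
Notation I := (intersection_ideal W).
Let S i := annihilator (W i).

Lemma intersection_idealE u : I u <-> ecap S u.
Proof.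
split=> h i; have := h i; rewrite (@eid_gen _ _ _ (S i)) //;
  exact: vanishing_formsP.
Qed.

Lemma intersection_is_ideal : is_ideal I.
Proof.
split=> [|u v|a u b]; rewrite !intersection_idealE.
- by move=> i; apply: eid0.
- by move=> uI vI i; apply: eid_add.
- by move=> uI i; have [_ _] := eid_ideal (S i); apply; apply: uI.
Qed.

Lemma intersection_hcomp d j u : I u -> I (hcomp d j u).
Proof. by rewrite !intersection_idealE => uI i; apply: eid_hcomp. Qed.

Definition row_ideal (v : 'rV[E]_1) := I (v 0 0).

Lemma row_ideal_acyclic a j : (t <= j)%N -> acyclic (fun=> 0%N) row_ideal a j.
Proof.
move=> tj c hc dc; rewrite -(card_ord t) in tj.
have hom (m : nat) (v : 'rV[E]_1) : free_homog (fun=> 0%N) m v <-> ext_homog m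
  (v 0 0).
  by split=> h; [move=> B /h; rewrite addn0|move=> k B; rewrite ord1 addn0;
    apply: h].
have [al da|be db|b [bP cE]] := @ecap_acyclic K char0 n _ S a j (fun al => c al
  0 0) tj.
- by have [/intersection_idealE cI /hom] := hc al da.
- by rewrite -cdiff_entry dc // mxE.
exists (fun be => const_mx (b be : E)); split=> [be db|al da].
  have [bI bh] := bP be db; split; last by apply/hom; rewrite mxE.
  by rewrite /row_ideal mxE intersection_idealE.
apply/rowP => k; rewrite ord1 cE // cdiff_entry; apply: eq_bigr => l _.
by rewrite mxE.
Qed.

(** By acyclicity in index degree 0, an element of [I] of degree above t is $\sum_k x_k b_k$ with
    all $b_k$ in [I] and of one degree less; induct on the degree. *)
Lemma intersection_generated : generated_in_degree_le t I.
Proof.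
move=> u; split=> [uI J [J0 JD JM] gJ|uG]; last first.
  by apply: uG; [exact: intersection_is_ideal|move=> g []].
have homJ d : forall v, I v -> ext_homog d v -> J v.
  elim: d => [|d IHd] v vI hv; first by apply: gJ; split=> //; exists 0%N.
  have [dt|td] := leqP d.+1 t; first by apply: gJ; split=> //; exists d.+1.
  have [al _|//|b [bP vE]] := row_ideal_acyclic td (a := 0) (c := fun=>
    const_mx v).
    by split=> [|k B]; rewrite ?/row_ideal !mxE // addn0; apply: hv.
  have := vE _ mdeg0; move/(congr1 (fun m : 'rV[E]_1 => m 0 0));
    rewrite mxE => ->.
  rewrite cdiff_entry /cdiff; elim/big_ind: _ => // k _.
  have [|bI bh] := bP (up k [ffun=> 0%N]); first by rewrite mdeg_up mdeg0.
  rewrite -[X in J X]mulr1; apply: JM; apply: IHd => // B.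
  by move/bh; rewrite addn0.
rewrite -(sum_hcomp u); elim/big_ind: _ => // d _; apply: (homJ d).
  exact: intersection_hcomp.
exact/ext_homogP/hcompK.
Qed.

Lemma resolution_tor_vanishes F i j : graded_free_resolution F I ->
  (i + t < j)%N -> tor_vanishes F i j.
Proof.
move=> [[hdiff haug] Iaug keraug kerdiff] ij v hv cyc.
have haug' k : free_homog (fun=> 0%N) (deg k) (row k (aug F)).
  by move=> l B; rewrite mxE ord1 addn0; apply: haug.
have Iaug' u : row_ideal u <-> exists w, u = w *m aug F.
  rewrite /row_ideal Iaug; split=> [[w wE]|[w ->]]; exists w => //.
  by apply/rowP => k; rewrite ord1.
have ker0 a m : (t <= m)%N -> acyclic (@deg _ _ F 0) (fun w => w *m aug F = 0)
  a.+1 m.+1.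
  move=> tm; apply: (syzygy_acyclic char0 haug' Iaug').
  exact: row_ideal_acyclic.
(* The kernel of [diff F l] is the syzygy module of order [l + 2], so its strands vanish above
   [t + l + 2]. *)
have kerS l : forall a m, (l + t <= m)%N ->
    acyclic (@deg _ _ F l.+1) (fun w => w *m diff F l = 0) a.+1 m.+2.
  elim: l => [|l IHl] a m lm.
    apply: (syzygy_acyclic char0 (hdiff 0%N) keraug).
    exact: ker0.
  case: m lm => // m lm.
  apply: (syzygy_acyclic char0 (hdiff l.+1) (kerdiff l)).
  exact: IHl.
(* For [i > 0], [tor_step] starts from the image of the module at place [i - 1]: the ideal itself
   for [i = 1], the kernel of the augmentation for [i = 2], the kernel of a differential beyond. *)
case: i => [|[|i]] in ij v hv cyc *.
- case: j => // j in ij hv *.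
  exact: (tor_step0 haug' Iaug' keraug (row_ideal_acyclic (a := 0) ij) hv).
- case: j => [|[|j]] // in ij hv *.
  exact: (tor_step haug' (hdiff 0%N) Iaug' keraug (kerdiff 0%N)
    (row_ideal_acyclic (a := 1) ij) hv cyc).
case: i => [|i] in ij v hv cyc *.
  case: j => [|[|[|j]]] // in ij hv *.
  exact: (tor_step (hdiff 0%N) (hdiff 1%N) keraug (kerdiff 0%N) (kerdiff 1%N)
    (ker0 0%N j ij) hv cyc).
case: j => [|[|[|[|j]]]] // in ij hv *.
exact: (tor_step (hdiff i.+1) (hdiff i.+2) (kerdiff i) (kerdiff i.+1)
  (kerdiff i.+2) (kerS i 0%N j ij) hv cyc).
Qed.
End Tor.

(** * Existence of resolutions *)

(** Adjoin vectors satisfying [P] until none is missing; the codimension bounds the number of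
    steps. *)
Lemma subspace_of_pred (K : fieldType) (V : vectType K) (P : V -> Prop) :
  P 0 -> (forall a u v, P u -> P v -> P (a *: u + v)) ->
  exists U : {vspace V}, forall v, P v <-> v \in U.
Proof.
move=> P0 Plin.
suff ext m : forall U : {vspace V}, (\dim {:V} - \dim U < m)%N ->
    (forall v, v \in U -> P v) -> exists U : {vspace V}, forall v, P v <-> v
      \in U.
  apply: (ext (\dim {:V} - \dim (0%VS : {vspace V})).+1 0%VS) => // v.
  by rewrite memv0 => /eqP ->.
elim: m => // m IHm U; rewrite ltnS => Um UP.
have [PU|] := pselect (forall v, P v -> v \in U).
  by exists U => v; split; [exact: PU|exact: UP].
move/existsNP => [v /not_implyP[Pv /negP vU]].
apply: (IHm (U + <[v]>)%VS) => [|w].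
  by apply: leq_trans Um; apply: codim_addv_line.
case/memv_addP => u uU [_ /vlineP[a ->] ->]; rewrite addrC.
exact/Plin/UP.
Qed.

Section Resolution.
Variables (K : fieldType) (n : nat).
Notation E := (exterior K n).

Definition graded_submodule r (d : 'I_r -> nat) (M : 'rV[E]_r -> Prop) :=
  [/\ M 0, forall (a : E) u v, M u -> M v -> M (a *: u + v)
    & forall j v, M v -> M (hrow d j v)].

(** Graded submodules are finite-dimensional over $K$, so bases of the graded pieces provide
    finitely many homogeneous generators. *)
Lemma graded_generators r (d : 'I_r -> nat) (M : 'rV[E]_r -> Prop) :
  graded_submodule d M -> exists r' (d' : 'I_r' -> nat) (D : 'M[E]_(r', r)),
    (forall k, free_homog d (d' k) (row k D)) /\
    forall v, M v <-> exists w : 'rV[E]_r', v = w *m D.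
Proof.
move=> [M0 Mlin Mh].
pose rowf (f : {ffun 'I_r -> E}) : 'rV[E]_r := \row_k f k.
have rowfD a f g : rowf (a *: f + g) = (a%:A : E) *: rowf f + rowf g.
  by apply/rowP => k; rewrite !mxE !ffunE -scalerAl mul1r.
have /choice[U UP] j : exists U : {vspace {ffun 'I_r -> E}},
    forall f, (M (rowf f) /\ hrow d j (rowf f) = rowf f) <-> f \in U.
  apply: subspace_of_pred => [|a f g [Mf hf] [Mg hg]].
    have -> : rowf 0 = 0 by apply/rowP => k; rewrite !mxE ffunE.
    by split=> //; apply/rowP => k; rewrite !mxE linear0.
  rewrite rowfD; split; first exact: Mlin.
  rewrite -{2}hf -{2}hg; apply/rowP => k; rewrite !mxE linearD /=.
  by rewrite -!scalerAl !mul1r linearZ.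
(* Exceeds every degree [#|B| + d k] of a monomial of the free module. *)
pose J := (n + \max_k d k).+1.
pose Q : finType := {j : 'I_J & 'I_(\dim (U j))}.
pose gen (p : Q) : 'rV[E]_r := rowf (vbasis (U (tag p)))`_(tagged p).
have genP p : M (gen p) /\ hrow d (tag p) (gen p) = gen p.
  by apply/UP; rewrite vbasis_mem // mem_nth // size_tuple.
pose ev (i : 'I_#|Q|) : Q := enum_val i.
exists #|Q|, (fun i => tag (ev i) : nat), (\matrix_(i, k) gen (ev i) 0 k).
have rowE i : row i (\matrix_(i, k) gen (ev i) 0 k) = gen (ev i).
  by apply/rowP => k; rewrite !mxE.
split=> [k|v]; first by rewrite rowE; apply/free_homogP/(genP _).2.
split=> [Mv|[w ->]]; last first.
  rewrite mulmx_sum_row; elim/big_ind: _ => // [x y Mx My|i _].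
    by rewrite -[x]scale1r; apply: Mlin.
  by rewrite rowE -[_ *: _]addr0; apply: Mlin => //; apply: (genP _).1.
pose f j : {ffun 'I_r -> E} := [ffun k => hrow d j v 0 k].
have rowf_f j : rowf (f j) = hrow d j v by apply/rowP => k;
  rewrite !mxE ffunE !mxE.
have fU j : f j \in U j.
  apply/UP; rewrite rowf_f; split; first exact: Mh.
  exact/free_homogP/hrow_homog.
have vE : v = \sum_(j < J) hrow d j v.
  apply/rowP => k; rewrite summxE; apply/ffunP => B; rewrite sum_ffunE.
  have BJ : (#|B| + d k < J)%N.
    rewrite ltnS leq_add //; last exact: leq_bigmax.
    by rewrite -[X in (_ <= X)%N]card_ord max_card.
  rewrite (bigD1 (Ordinal BJ)) //= mxE ffunE eqxx big1 ?addr0 // => j jB.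
  rewrite mxE ffunE ifF //; apply: contraNF jB => /eqP jE.
  by apply/eqP/val_inj; rewrite /= jE.
exists (\row_i (coord (vbasis (U (tag (ev i)))) (tagged (ev i))
  (f (tag (ev i))))%:A).
rewrite mulmx_sum_row [LHS]vE.
pose F j (b : 'I_(\dim (U j))) : 'rV[E]_r :=
  ((coord (vbasis (U j)) b (f j))%:A : E) *: rowf (vbasis (U j))`_b.
rewrite (eq_bigr (fun j : 'I_J => \sum_(b < \dim (U j)) F j b)); last first.
  move=> j _; rewrite -rowf_f {1}(coord_vbasis (fU j)).
  elim/big_rec2: _ => [|b x y _ <-]; first by apply/rowP => k;
    rewrite !mxE ffunE.
  exact: rowfD.
rewrite (sig_big_dep xpredT (fun _ _ => true) (fun (j : 'I_J) (b : 'I_(\dim (U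
  j))) => F j b)) /=.
rewrite (reindex ev) /=; last first.
  by apply: onW_bij; apply: enum_val_bij.
by apply: eq_bigr => i _; rewrite rowE mxE.
Qed.

(* A step of the resolution: sdiff maps the free module of degrees sdeg' to the
   one of degrees sdeg, and the next step covers its kernel. *)
Record stage := Stage {
  srank : nat; sdeg : 'I_srank -> nat;
  srank' : nat; sdeg' : 'I_srank' -> nat;
  sdiff : 'M[E]_(srank', srank);
  sdiff_homog : forall k, free_homog sdeg (sdeg' k) (row k sdiff)
}.

Lemma kernel_graded_submodule (s : stage) :
  graded_submodule (@sdeg' s) (fun w => w *m sdiff s = 0).
Proof.
split=> [|a u v u0 v0|j v v0]; first exact: mul0mx.
  by rewrite mulmxDl -scalemxAl u0 v0 scaler0 addr0.
rewrite -(hrow_mul (@sdiff_homog s)) v0.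
by apply/rowP => k; rewrite !mxE linear0.
Qed.

(** Iteration needs rank, degrees and matrix as data, so they are chosen in turn from the nested
    existential. *)
Definition stage_rank s := cid (graded_generators (kernel_graded_submodule s)).
Definition stage_deg s := cid (svalP (stage_rank s)).
Definition stage_diff s := cid (svalP (stage_deg s)).
Definition next_stage (s : stage) : stage :=
  @Stage (srank' s) (@sdeg' s) _ _ (sval (stage_diff s)) (svalP (stage_diff
    s)).1.

Lemma next_stageP s (v : 'rV[E]_(srank' s)) :
  v *m sdiff s = 0 <-> exists w, v = w *m sdiff (next_stage s).
Proof. exact: (svalP (stage_diff s)).2. Qed.

Lemma graded_submodule_resolution (I : E -> Prop) :
  graded_submodule (fun _ : 'I_1 => 0%N) (fun v => I (v 0 0)) ->
  exists F, graded_free_resolution F I.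
Proof.
move=> gI; have [r0 [d0 [D0 [hD0 ID0]]]] := graded_generators gI.
pose st := fix st i := if i is i'.+1 then next_stage (st i') else @Stage 1 _ r0
  d0 D0 hD0.
exists (@FreeSequence K n (fun i => srank' (st i)) (fun i => @sdeg' (st i))
  (fun i => sdiff (st i.+1)) D0); split.
- split=> [i k|k B]; first exact: (@sdiff_homog (st i.+1)).
  by move=> DB; have := @hD0 k 0 B; rewrite mxE addn0; apply.
- move=> u; have := ID0 (const_mx u); rewrite mxE => ->.
  split=> [[w wE]|[w uE]]; exists w; first by rewrite -wE mxE.
  by apply/rowP => k; rewrite ord1 mxE uE.
- exact: (@next_stageP (st 0%N)).
- by move=> i; apply: (@next_stageP (st i.+1)).
Qed.

End Resolution.

Theorem theorem9 (K : fieldType) (char0 : [pchar K] =i pred0) (n t : nat)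
    (W : 'I_t -> {vspace 'rV[K]_n}) :
  cm_regular t (intersection_ideal W) /\
  generated_in_degree_le t (intersection_ideal W).
Proof.
split; last exact: intersection_generated.
split; last by move=> F resF i j; apply: (resolution_tor_vanishes char0 resF).
have [I0 ID IM] := intersection_is_ideal W.
apply: graded_submodule_resolution; split=> [|a u v uI vI|j v vI].
- by rewrite mxE.
- by rewrite !mxE; apply: ID => //; rewrite -[a * _]mulr1; apply: IM.
- by rewrite mxE; apply: intersection_hcomp.
Qed.
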